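(* Let $u\in\mathcal{L}PSH^*(\mathbb{C}^n)$ be toric and let $K$ be a compact set containing the unit polydisk $\mathbb{D}^n$. Then \[ \int_{\mathbb{C}^n\setminus K}e^{-2cu}\,d\lambda<\infty \] if and only if \[ c>\sup\left\{\frac{\langle t,\mathbf 1\rangle}{\psi_u(t)}:\ t\in H_+\right\} \] (in other words, $c^{-1}\mathbf 1$ lies in the interior of $\Gamma_{u,\infty}$). Consequently, \[ c_\infty(u)=c_\infty(\Psi_u)=\sup\left\{\frac{\langle t,\mathbf 1\rangle}{\psi_u(t)}:\ t\in H_+\right\}=\inf\{c>0:\ c^{-1}\mathbf 1\in\Gamma_{u,\infty}\}. \]
   Context: $\mathcal{L}PSH(\mathbb{C}^n)$ is the class of plurisubharmonic functions $u$ on $\mathbb{C}^n$ with $\limsup_{|z|\to\infty}u(z)/\log|z|<\infty$; $\mathcal{L}PSH^*(\mathbb{C}^n)$ is the subclass of those with $u(z)\to+\infty$ as $|z|\to\infty$. A function $u$ is toric if $u(z)=u(|z_1|,\ldots,|z_n|)$. The logarithmic indicator of $u\in\mathcal{L}PSH(\mathbb{C}^n)$ is $\Psi_u(z)=\lim_{R\to\infty}R^{-1}\sup\{u(\zeta): |\zeta_k|\le|z_k|^R,\ 1\le k\le n\}$ for $z$ with $z_1\cdots z_n\ne0$, extended to $\mathbb{C}^n$ by continuity; $\psi_u(t)=\Psi_u(e^{t_1},\ldots,e^{t_n})$ for $t\in\mathbb{R}^n$. The indicator diagram of $u$ at infinity is $\Gamma_{u,\infty}=\{a\in\mathbb{R}^n:\langle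 a,t\rangle\le\max\{\psi_u(t),0\}\ \forall t\in\mathbb{R}^n\}$. $\mathbf 1=(1,\ldots,1)$, $H_+=\{t\in\mathbb{R}^n:\sum_kt_k>0\}$, $d\lambda$ is Lebesgue measure. $g\in L^2(\infty)$ means $\int_{\mathbb{C}^n\setminus K'}|g|^2d\lambda<\infty$ for some compact $K'$; $c_\infty(u)=\inf\{c>0:e^{-cu}\in L^2(\infty)\}$. *)

(* Defs.v *)
(* C^n is represented in real coordinates:
   a point z of C^n is a pair (x, y) of real row vectors, z_k = x_k + i y_k. *)
From HB Require Import structures.
From mathcomp Require Import all_boot all_order all_algebra.
From mathcomp Require Import all_classical all_reals all_analysis.
Set Implicit Arguments.
Unset Strict Implicit.
Unset Printing Implicit Defensive.
Import Order.TTheory GRing.Theory Num.Theory.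
Import numFieldNormedType.Exports.
Local Open Scope classical_set_scope.
Local Open Scope ring_scope.

Definition Cn (R : realType) (n : nat) := ('rV[R]_n * 'rV[R]_n)%type.

Definition cabs (R : realType) (n : nat) (z : Cn R n) (k : 'I_n) : R :=
  Num.sqrt (z.1 ord0 k ^+ 2 + z.2 ord0 k ^+ 2).

Definition cnorm (R : realType) (n : nat) (z : Cn R n) : R :=
  Num.sqrt (\sum_(k < n) (z.1 ord0 k ^+ 2 + z.2 ord0 k ^+ 2)).

(* the point a + e^{i theta} b of C^n *)
Definition rotadd (R : realType) (n : nat) (a b : Cn R n) (theta : R) : Cn R n :=
  (\row_k (a.1 ord0 k + cos theta * b.1 ord0 k - sin theta * b.2 ord0 k),
   \row_k (a.2 ord0 k + sin theta * b.1 ord0 k + cos theta * b.2 ord0 k)).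

Local Open Scope ereal_scope.

Definition psh (R : realType) (n : nat) (u : Cn R n -> \bar R) : Prop :=
  [/\ (forall z, u z != +oo),
      (exists z, u z != -oo),
      lower_semicontinuous (fun z => - u z) &
      (forall a b : Cn R n,
        u a <= ((2 * pi)^-1)%:E *
               \int[lebesgue_measure]_(theta in `[0%R, (2 * pi)%R]) u (rotadd a b theta))].

Definition LPSH (R : realType) (n : nat) (u : Cn R n -> \bar R) : Prop :=
  psh u /\ exists C r0 : R, forall z, (r0 < cnorm z)%R -> u z <= (C * ln (cnorm z))%:E.

Definition LPSHstar (R : realType) (n : nat) (u : Cn R n -> \bar R) : Prop :=
  LPSH u /\ forall M : R, exists r0 : R, forall z, (r0 < cnorm z)%R -> M%:E < u z.

Definition modpt (R : realType) (n : nat) (z : Cn R n) : Cn R n :=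
  (\row_k cabs z k, (0 : 'rV[R]_n)%R).

Definition toric (R : realType) (n : nat) (u : Cn R n -> \bar R) : Prop :=
  forall z, u z = u (modpt z).

Definition Cstar (R : realType) (n : nat) : set (Cn R n) :=
  [set z | forall k, cabs z k != 0%R].

Definition Psi0 (R : realType) (n : nat) (u : Cn R n -> \bar R) (z : Cn R n) : \bar R :=
  lim ((fun r : R => (r^-1)%:E *
          ereal_sup [set u w | w in [set w : Cn R n | forall k, (cabs w k <= cabs z k `^ r)%R]])
       @ +oo%R).

(* logarithmic indicator on C^n, extended from (C^* )^n by (upper) continuity *)
Definition Psi (R : realType) (n : nat) (u : Cn R n -> \bar R) (z : Cn R n) : \bar R :=
  if pselect (Cstar z) then Psi0 u z
  else limf_esup (Psi0 u) (within (@Cstar R n) (nbhs z)).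

Definition psi (R : realType) (n : nat) (u : Cn R n -> \bar R) (t : 'rV[R]_n) : \bar R :=
  Psi u (\row_k expR (t ord0 k), (0 : 'rV[R]_n)%R).

Definition dotR (R : realType) (n : nat) (a t : 'rV[R]_n) : R := (\sum_(k < n) a ord0 k * t ord0 k)%R.

Definition one_vec (R : realType) (n : nat) : 'rV[R]_n := const_mx 1%R.

Definition Gamma_inf (R : realType) (n : nat) (u : Cn R n -> \bar R) : set 'rV[R]_n :=
  [set a | forall t : 'rV[R]_n, (dotR a t)%:E <= maxe (psi u t) 0].

Definition Hplus (R : realType) (n : nat) : set 'rV[R]_n :=
  [set t | (0 < dotR t (one_vec R n))%R].

(* x / y for x > 0 and y in \bar R, with x/0 = +oo (and x/(+oo) = 0) *)
Definition eratio (R : realType) (x : R) (y : \bar R) : \bar R :=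
  match y with
  | EFin r => if (r <= 0)%R then +oo else (x / r)%:E
  | +oo => 0
  | -oo => +oo
  end.

Definition sup_ratio (R : realType) (n : nat) (u : Cn R n -> \bar R) : \bar R :=
  ereal_sup [set eratio (dotR t (one_vec R n)) (psi u t) | t in @Hplus R n].

(* Lebesgue integral over R^m of a nonnegative function, written as an
   iterated integral (Tonelli) *)
Fixpoint iter_int (R : realType) (m : nat) (g : (nat -> R) -> \bar R) : \bar R :=
  match m with
  | 0 => g (fun _ => 0%R)
  | m'.+1 => \int[lebesgue_measure]_(t in [set: R])
               iter_int m' (fun s => g (fun j => if j == m' then t else s j))
  end.

Definition Cn_integral (R : realType) (n : nat) (f : Cn R n -> \bar R) : \bar R :=
  iter_int (2 * n) (fun s => f (\row_k s (nat_of_ord k), \row_k s (n + k)%N)).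

Definition int_outside (R : realType) (n : nat) (K : set (Cn R n)) (f : Cn R n -> \bar R) :=
  Cn_integral (fun z => if pselect (K z) then 0 else f z).

Definition L2inf (R : realType) (n : nat) (g : Cn R n -> \bar R) : Prop :=
  exists K' : set (Cn R n), compact K' /\
    int_outside K' (fun z => `|g z| * `|g z|) < +oo.

Definition c_inf (R : realType) (n : nat) (u : Cn R n -> \bar R) : \bar R :=
  ereal_inf [set c%:E | c in [set c : R | (0 < c)%R /\ L2inf (fun z => expeR (- c%:E * u z))]].

Definition unit_polydisk (R : realType) (n : nat) : set (Cn R n) :=
  [set z | forall k, (cabs z k < 1)%R].

(* Main.v *)
Require Import Defs.
From HB Require Import structures.
From mathcomp Require Import all_boot all_order all_algebra.
From mathcomp Require Import all_classical all_reals all_analysis.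
From mathcomp Require Import measurable_realfun.
From mathcomp Require Import ring lra.
Import Order.TTheory GRing.Theory Num.Theory.
Import numFieldNormedType.Exports.
Local Open Scope classical_set_scope.
Local Open Scope ring_scope.

(* In logarithmic coordinates a toric [u] becomes [phi(t) = u(e^t)] on R^n. For psh [u]
   the function [phi] is convex and nondecreasing in each variable, the supremum of [u]
   over a polydisk is a value of [phi], and hence [psi_u] is the recession function of
   [phi]. Up to constants the integral of [e^(-2cu)] is that of [e^(-2(c phi(t) - <t,1>))].
   If [<t,1> < c psi_u(t)] on [H_+], compactness of the sphere and convexity give
   [c phi(t) >= <t,1> + d |t| - C] whenever some [t_k >= 0], that is, off the open unit
   polydisk, and the integrand is dominated by a product of integrable functions of the
   single real coordinates. If [c psi_u(t) <= <t,1>] for some [t] in [H_+], the boxes of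
   size [e^(N t_k)] around [e^(N t)] each contribute at least a fixed positive amount.
   Since [psi_u] is its own recession function, the same applies to [Psi_u]. *)

(** * Recession functions of convex exhaustions *)

(** Plurisubharmonicity is available only as a sub-mean inequality on affine discs, which are curved
    in logarithmic coordinates; log-convexity therefore needs a second-order argument at a touching
    point, where the curvature averages out. Since [u] is only upper semicontinuous and may a priori
    be [-oo], finiteness of its profile is itself a consequence of convexity and of [u -> +oo].
    Neither [u] nor [Psi u] is shown to be measurable: their integrals are only compared with
    explicit sums of products of one-variable functions. The condition [sup_ratio u < c] is strict
    at the supremum, [dominates] only pointwise. The uniform margin [d] obtained by compactness
    closes this gap, and the same margin yields integrability and a ball inside [Gamma_inf]. *)

Definition convex_exhaustion {R : realType} {n : nat} (phi : 'rV[R]_n -> R) : Prop :=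
  [/\ (forall p v s, 0 <= s <= 1 -> phi (p + s *: v) <= phi p + s * (phi (p + v) - phi p)),
      (forall t t' : 'rV[R]_n, (forall k, t ord0 k <= t' ord0 k) -> phi t <= phi t'),
      (forall M, exists T, forall (t : 'rV[R]_n) k, T <= t ord0 k -> M < phi t) &
      (exists C T, forall m, T <= m -> phi (const_mx m) <= C * m)].

Definition slope {R : realType} {n : nat} (phi : 'rV[R]_n -> R) (t : 'rV[R]_n) (r : R) : R :=
  (phi (r *: t) - phi 0) / r.

(** Slopes of a convex function from 0 increase with [r], so this supremum is the limit of
    [phi (r t) / r]; as a supremum it also bounds each single slope. *)
Definition recession {R : realType} {n : nat} (phi : 'rV[R]_n -> R) (t : 'rV[R]_n) : R :=
  sup [set slope phi t r | r in [set r | 0 < r]].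

(** Stands in for letting [s] tend to 0: the test value [a / (a + 2 |K|)] is at most 1 and makes
    [s |K|] smaller than [a]. *)
Lemma le0_of_le_mul {R : realType} (a K : R) :
  (forall s, 0 < s <= 1 -> a <= s * K) -> a <= 0.
Proof.
move=> h; rewrite leNgt; apply/negP => a0.
have K0 : 0 <= `|K| by [].
have [s0 s1] : 0 < a / (a + 2 * `|K|) /\ a / (a + 2 * `|K|) <= 1.
  by split; [rewrite divr_gt0 //; lra|rewrite ler_pdivrMr; lra].
have := h (a / (a + 2 * `|K|)); rewrite s0 s1 => /(_ isT) h1.
have : a / (a + 2 * `|K|) * K <= a / (a + 2 * `|K|) * `|K|.
  by rewrite ler_wpM2l ?ler_norm // ltW.
move=> /(le_trans h1); rewrite mulrAC ler_pdivlMr; last lra.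
nra.
Qed.

Lemma slope_homo {R : realType} {n : nat} (phi : 'rV[R]_n -> R) (t : 'rV[R]_n) (r r' : R) :
  convex_exhaustion phi -> 0 < r -> r <= r' -> slope phi t r <= slope phi t r'.
Proof.
move=> [cvx _ _ _] r0 rr'; have r'0 : 0 < r' by exact: lt_le_trans rr'.
rewrite /slope ler_pdivrMr // mulrAC -mulrA [_ * (_ / _)]mulrC.
rewrite lerBlDl; have := cvx 0 (r' *: t) (r / r').
rewrite !add0r scalerA mulfVK ?gt_eqF //; apply.
by rewrite divr_ge0 ?(ltW r0) ?(ltW r'0) //= ler_pdivrMr // mul1r.
Qed.

Lemma slope_bounded {R : realType} {n : nat} (phi : 'rV[R]_n -> R) (t : 'rV[R]_n) :
  convex_exhaustion phi -> exists B, forall r, 0 < r -> slope phi t r <= B.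
Proof.
move=> ce; have [_ hom _ [C [T up]]] := ce.
pose m := 1 + \sum_k `|t ord0 k|.
have m1 : 1 <= m by rewrite lerDl sumr_ge0.
exists (`|C| * m + `|phi 0|) => r r0.
(* Slopes increase, so it suffices to bound the one at a larger [r'], where the diagonal growth
   bound applies to [r' m], which dominates [r' t] coordinatewise. *)
pose r' := r + 1 + `|T|.
have rr' : r <= r' by rewrite /r' -addrA lerDl addr_ge0.
have T0 : 0 <= `|T| by [].
have r'1 : 1 <= r' by rewrite /r'; lra.
apply: le_trans (slope_homo phi t _ _ ce r0 rr') _.
rewrite /slope ler_pdivrMr; last lra.
have : phi (r' *: t) <= phi (const_mx (r' * m)).
  apply: hom => k; rewrite !mxE ler_wpM2l //; first lra.
  apply: le_trans (ler_norm _) _; rewrite /m (bigD1 k) //=.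
  by rewrite addrCA lerDl addr_ge0 // sumr_ge0.
have : phi (const_mx (r' * m)) <= C * (r' * m).
  apply: up; have := ler_norm T; rewrite /r'; nra.
have : C * (r' * m) <= `|C| * (r' * m) by rewrite ler_wpM2r ?ler_norm // mulr_ge0; lra.
have := ler_norm (- phi 0); rewrite normrN.
have := normr_ge0 (phi 0); nra.
Qed.

Lemma slope_has_sup {R : realType} {n : nat} (phi : 'rV[R]_n -> R) (t : 'rV[R]_n) :
  convex_exhaustion phi -> has_sup [set slope phi t r | r in [set r | 0 < r]].
Proof.
move=> ce; split; first by exists (slope phi t 1), 1 => /=.
by have [B hB] := slope_bounded phi t ce; exists B => _ [r r0 <-]; exact: hB.
Qed.

Lemma slope_le_recession {R : realType} {n : nat} (phi : 'rV[R]_n -> R) (t : 'rV[R]_n) r :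
  convex_exhaustion phi -> 0 < r -> slope phi t r <= recession phi t.
Proof.
by move=> ce r0; apply: (ub_le_sup (slope_has_sup phi t ce).2); exists r.
Qed.

Lemma recession_gt {R : realType} {n : nat} (phi : 'rV[R]_n -> R) (t : 'rV[R]_n) a :
  convex_exhaustion phi -> a < recession phi t ->
  exists2 r, 0 < r & forall r', r <= r' -> a < slope phi t r'.
Proof.
move=> ce /(sup_gt (slope_has_sup phi t ce).1) [_ [r r0 <-] ar].
by exists r => // r' rr'; apply: lt_le_trans ar (slope_homo phi t _ _ ce r0 rr').
Qed.

Lemma recession_ub {R : realType} {n : nat} (phi : 'rV[R]_n -> R) (t : 'rV[R]_n) r :
  convex_exhaustion phi -> 0 < r -> phi (r *: t) <= phi 0 + r * recession phi t.
Proof.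
move=> ce r0; have := slope_le_recession phi t r ce r0.
by rewrite /slope ler_pdivrMr // lerBlDl mulrC.
Qed.

Lemma recession_cvg {R : realType} {n : nat} (phi : 'rV[R]_n -> R) (t : 'rV[R]_n) :
  convex_exhaustion phi -> r^-1 * phi (r *: t) @[r --> +oo] --> recession phi t.
Proof.
move=> ce; apply/cvgrPdist_lt => e e0.
have [r1 r10 hr1] := recession_gt phi t (recession phi t - e / 2) ce ltac:(lra).
near=> r.
have r1r : r1 <= r by near: r; apply: nbhs_pinfty_ge; exact: num_real.
have r0 : 0 < r by exact: lt_le_trans r1r.
have hr : 2 * `|phi 0| / e < r by near: r; apply: nbhs_pinfty_gt; exact: num_real.
have -> : r^-1 * phi (r *: t) = slope phi t r + phi 0 / r.
  by rewrite /slope; field; rewrite gt_eqF.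
have h1 := hr1 _ r1r; have h2 := slope_le_recession phi t r ce r0.
have h3 : `|phi 0 / r| < e / 2.
  rewrite normrM normfV (gtr0_norm r0) ltr_pdivrMr //.
  by rewrite ltr_pdivrMr // in hr; lra.
move: h3; rewrite !ltr_norml => /andP[h3 h4]; apply/andP; split; lra.
Unshelve. all: by end_near.
Qed.

(** Since [s] is the midpoint of [s - e 1] and [s + e 1], the drop of [phi] over the backward step
    is at most its rise over the forward one, which convexity bounds by [e] times the rise over a
    unit step. Monotonicity covers the other [s']. *)
Lemma convex_lower_estimate {R : realType} {n : nat} (phi : 'rV[R]_n -> R)
    (s s' : 'rV[R]_n) e :
  convex_exhaustion phi -> 0 <= e <= 1 -> (forall k, s ord0 k - e <= s' ord0 k) ->
  phi s - e * (phi (s + const_mx 1) - phi s) <= phi s'.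
Proof.
move=> [cvx hom _ _] e01 ss'.
have h1 : phi (s - const_mx e) <= phi s' by apply: hom => k; rewrite !mxE; exact: ss'.
have h2 := cvx s (const_mx 1) e e01.
have h3 := cvx (s - const_mx e) (const_mx (2 * e)) 2^-1 ltac:(lra).
have E1 : s - const_mx e + 2^-1 *: const_mx (2 * e) = s.
  by apply/rowP => k; rewrite !mxE; field.
have E2 : s - const_mx e + const_mx (2 * e) = s + e *: const_mx 1.
  by apply/rowP => k; rewrite !mxE; ring.
rewrite E1 E2 in h3; lra.
Qed.

(** The point [(1 - s) x + r t] lies on the segment from [x] to [(r / s) t], whose far end obeys the
    bound from 0. As [s -> 0] it tends to [x + r t], and [convex_lower_estimate] controls the
    displacement [s x]. *)
Lemma recession_shift {R : realType} {n : nat} (phi : 'rV[R]_n -> R) (x t : 'rV[R]_n) r :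
  convex_exhaustion phi -> 0 <= r -> phi (x + r *: t) <= phi x + r * recession phi t.
Proof.
move=> ce; rewrite le_eqVlt => /orP[/eqP <-|r0]; first by rewrite scale0r mul0r !addr0.
have [cvx hom _ _] := ce.
pose X := 1 + \sum_k `|x ord0 k|.
have Xk k : `|x ord0 k| <= X.
  by rewrite /X (bigD1 k) //= addrCA lerDl addr_ge0 // sumr_ge0.
have X1 : 1 <= X by rewrite lerDl sumr_ge0.
pose D := phi (x + r *: t + const_mx 1) - phi (x + r *: t).
rewrite -subr_le0; apply: (@le0_of_le_mul _ _ (D + (phi 0 - phi x) / X)) => e /andP[e0 e1].
pose s := e / X.
have eX : e = s * X by rewrite /s mulfVK // gt_eqF //; lra.
have s0 : 0 < s by rewrite divr_gt0 //; lra.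
have s1 : s <= 1 by rewrite /s ler_pdivrMr; lra.
have := cvx x ((r / s) *: t - x) s ltac:(lra).
rewrite subrKC => h1.
have h2 := recession_ub phi t (r / s) ce (divr_gt0 r0 s0).
have := convex_lower_estimate phi (x + r *: t) (x + s *: ((r / s) *: t - x)) e ce ltac:(lra).
have -> : s *: ((r / s) *: t - x) = r *: t - s *: x.
  by rewrite scalerBr scalerA mulrCA divff ?mulr1 // gt_eqF.
move=> h3.
have {}h3 : phi (x + r *: t) - e * D <= phi (x + (r *: t - s *: x)).
  apply: h3 => k; rewrite !mxE addrA lerD2l lerN2 eX ler_pM2l //.
  exact: le_trans (ler_norm _) (Xk k).
have sr : s * (r / s) = r by rewrite mulrCA divff ?mulr1 // gt_eqF.
have -> : e * (D + (phi 0 - phi x) / X) = e * D + s * (phi 0 - phi x).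
  by rewrite /s; field; rewrite gt_eqF //; lra.
move: h1; rewrite scalerBr scalerA mulrCA divff ?gt_eqF // mulr1 => h1.
have := ler_wpM2l (ltW s0) h2; rewrite mulrDr [s * (r / s * _)]mulrA sr.
by move: h3; rewrite /D; lra.
Qed.

Lemma recession_gt0 {R : realType} {n : nat} (phi : 'rV[R]_n -> R) (t : 'rV[R]_n) k :
  convex_exhaustion phi -> 0 < t ord0 k -> 0 < recession phi t.
Proof.
move=> ce tk; have [_ _ low _] := ce; have [T hT] := low (phi 0).
pose r := (`|T| + 1) / t ord0 k.
have r0 : 0 < r by rewrite divr_gt0 // ltr_wpDl.
apply: lt_le_trans (slope_le_recession phi t r ce r0).
rewrite divr_gt0 // subr_gt0; apply: (hT _ k).
by rewrite mxE mulfVK ?gt_eqF //; have := ler_norm T; lra.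
Qed.

(** Cut the coordinates of [t] down to at most 0, so that the k-th becomes 0, and go up [2 T'] along
    axis [k]: the midpoint has [phi > 0] and the far end is below a fixed diagonal point, so
    convexity bounds the near end from below, however negative the other coordinates are. *)
Lemma convex_exhaustion_bounded_below {R : realType} {n : nat} (phi : 'rV[R]_n -> R) :
  convex_exhaustion phi -> exists m0, forall (t : 'rV[R]_n) k, 0 <= t ord0 k -> m0 <= phi t.
Proof.
move=> [cvx hom low _]; have [T hT] := low 0.
pose T' := `|T|; exists (- phi (const_mx (2 * T'))) => t k tk.
have T0 : 0 <= T' by rewrite /T'.
pose s : 'rV[R]_n := \row_j Num.min (t ord0 j) 0.
apply: (@le_trans _ _ (phi s)); last by apply: hom => j; rewrite mxE ge_min lexx.
have sk : s ord0 k = 0 by rewrite mxE; apply/min_idPr.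
have h1 := cvx s ((2 * T') *: delta_mx ord0 k) 2^-1 ltac:(lra).
have h2 : 0 < phi (s + 2^-1 *: ((2 * T') *: delta_mx ord0 k)).
  apply: (hT _ k); rewrite scalerA !mxE !eqxx mulr1.
  rewrite -/(Num.min _ _); have := sk; rewrite mxE => ->.
  by rewrite add0r mulKf // ler_norm.
have h3 : phi (s + (2 * T') *: delta_mx ord0 k) <= phi (const_mx (2 * T')).
  apply: hom => j; rewrite !mxE; case: (ord0 == ord0 :> 'I_1) => //=; last first.
    by rewrite mulr0 addr0 ge_min mulr_ge0 ?orbT.
  have : Num.min (t ord0 j) 0 <= 0 by rewrite ge_min lexx orbT.
  by case: (j == k) => /=; nra.
lra.
Qed.

(* The condition [c > sup_ratio u] in terms of the recession function of [u]. *)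
Definition dominates {R : realType} {n : nat} (phi : 'rV[R]_n -> R) (c : R) : Prop :=
  forall t : 'rV[R]_n, 0 < \sum_k t ord0 k -> \sum_k t ord0 k < c * recession phi t.

Lemma recession_ge0 {R : realType} {n : nat} (phi : 'rV[R]_n -> R) (t : 'rV[R]_n) k :
  convex_exhaustion phi -> 0 <= t ord0 k -> 0 <= recession phi t.
Proof.
move=> ce tk; have [m0 hm] := convex_exhaustion_bounded_below phi ce.
rewrite -oppr_le0; apply: (@le0_of_le_mul _ _ (`|m0| + `|phi 0|)) => s /andP[s0 s1].
have rs0 : 0 < s^-1 by rewrite invr_gt0.
have := slope_le_recession phi t s^-1 ce rs0; rewrite /slope invrK => h.
have := hm (s^-1 *: t) k; rewrite mxE mulr_ge0 ?(ltW rs0) // => /(_ isT) h2.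
have := ler_norm (- m0); have := ler_norm (phi 0); rewrite normrN => h3 h4.
have : - (`|m0| + `|phi 0|) <= phi (s^-1 *: t) - phi 0 by lra.
move=> /(ler_wpM2r (ltW s0)); lra.
Qed.

(** If the sum is at most 0, either a positive coordinate makes the recession positive, or all
    coordinates are nonpositive and the sum is negative. Compactness needs strictness on these
    closed half-spaces. *)
Lemma dominated_recession_gt0 {R : realType} {n : nat} (phi : 'rV[R]_n -> R) c (t : 'rV[R]_n) k :
  convex_exhaustion phi -> 0 < c ->
  dominates phi c ->
  t != 0 -> 0 <= t ord0 k -> \sum_k t ord0 k < c * recession phi t.
Proof.
move=> ce c0 dom tn0 tk.
have [|sle] := ltP 0 (\sum_k t ord0 k); first exact: dom.
have [/existsP[i ti]|] := boolP [exists i, 0 < t ord0 i].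
  by apply: le_lt_trans sle _; rewrite mulr_gt0 // (recession_gt0 phi t i ce ti).
rewrite negb_exists => /forallP tneg.
apply: lt_le_trans (_ : 0 <= _); last by rewrite mulr_ge0 ?(ltW c0) // (recession_ge0 phi t k).
rewrite lt_neqAle sle andbT; apply/negP => /eqP s0; case/negP: tn0; apply/eqP/rowP => i.
have tle j : t ord0 j <= 0 by rewrite leNgt.
rewrite mxE; apply/eqP; rewrite eq_le tle /=.
have : \sum_(j | j != i) t ord0 j <= 0 by apply: sumr_le0 => j _; exact: tle.
by move: s0; rewrite (bigD1 i) //=; lra.
Qed.

(* Compactness of the sphere for the maximum norm, one facet [s_j = sg] and one
   half-space [s_k >= 0] at a time. *)
Lemma facet_slope {R : realType} {n : nat} (phi : 'rV[R]_n -> R) c (j k : 'I_n) (sg : R) :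
  convex_exhaustion phi -> 0 < c -> sg != 0 ->
  dominates phi c ->
  \forall r \near +oo, forall s : 'rV[R]_n, (forall i, `|s ord0 i| <= 1) ->
    s ord0 j = sg -> 0 <= s ord0 k ->
    1 <= c * (phi (r *: s) - phi 0) - r * \sum_i s ord0 i.
Proof.
move=> ce c0 sg0 dom.
(* When [j = k] and [sg < 0] the bounds cross and the box is empty, as it should be. *)
pose lo i : R :=
  if i == k then (if i == j then Num.max sg 0 else 0) else (if i == j then sg else -1).
pose hi i : R := if i == j then sg else 1.
pose K := [set s : 'rV[R]_n | forall i, `[lo i, hi i]%classic (s ord0 i)].
have cK : compact K.
  by apply: (@rV_compact R n (fun i => `[lo i, hi i]%classic)) => i; exact: segment_compact.
have KE (s : 'rV[R]_n) : K s -> s ord0 j = sg /\ 0 <= s ord0 k.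
  move=> Ks; have := Ks j; have := Ks k; rewrite /= !in_itv /= /lo /hi.
  have [<-|jk] := eqVneq j k.
    rewrite !eqxx ge_max => /andP[/andP[h1 h2] h3] _.
    have <- : s ord0 j = sg by apply/eqP; rewrite eq_le h1 h3.
    by [].
  rewrite !eqxx => /andP[h1 _] /andP[h2 h3]; split => //.
  by apply/eqP; rewrite eq_le h2 h3.
have KI (s : 'rV[R]_n) : (forall i, `|s ord0 i| <= 1) -> s ord0 j = sg -> 0 <= s ord0 k -> K s.
  move=> s1 sj sk i; rewrite /= in_itv /= /lo /hi; have := s1 i; rewrite ler_norml => /andP[h1 h2].
  have [ik|_] := eqVneq i k; have [ij|_] := eqVneq i j.
  - have e1 : s ord0 i = sg by rewrite ij sj.
    have e2 : 0 <= s ord0 i by rewrite ik.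
    by rewrite ge_max e2 e1 lexx.
  - by rewrite ik sk -ik h2.
  - by rewrite ij sj lexx.
  - by rewrite h1 h2.
have [cvx _ _ _] := ce.
(* Divided by the radius, the surplus 1 becomes [r^-1]; in this form the condition passes to all
   larger radii because slopes increase. *)
have conv (s : 'rV[R]_n) r r' : 0 < r -> r <= r' -> r^-1 <= c * slope phi s r - \sum_i s ord0 i ->
    1 <= c * (phi (r' *: s) - phi 0) - r' * \sum_i s ord0 i.
  move=> r0 rr' h; have r'0 : 0 < r' by exact: lt_le_trans rr'.
  have h1 : r^-1 <= c * slope phi s r' - \sum_i s ord0 i.
    apply: le_trans h _; rewrite lerD2r ler_pM2l //; exact: slope_homo.
  have h2 : r' * (c * slope phi s r' - \sum_i s ord0 i) =
      c * (phi (r' *: s) - phi 0) - r' * \sum_i s ord0 i.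
    by rewrite /slope; field; rewrite gt_eqF.
  rewrite -h2; apply: (@le_trans _ _ (r' * r^-1)); last by rewrite ler_pM2l.
  by rewrite ler_pdivlMr // mul1r.
have pt (s : 'rV[R]_n) : K s -> exists2 r, 0 < r & r^-1 < c * slope phi s r - \sum_i s ord0 i.
  move=> /KE [sj sk].
  have sn0 : s != 0 by apply: contra_neq sg0 => s0; rewrite -sj s0 mxE.
  have pos := dominated_recession_gt0 phi c s k ce c0 dom sn0 sk.
  (* Half of the gap: the slope comes within [a / c] of the recession, and a radius of at least
     [a^-1] fits [r^-1] into the other half. *)
  pose a := (c * recession phi s - \sum_i s ord0 i) / 2.
  have a0 : 0 < a by rewrite divr_gt0 // subr_gt0.
  have [|r r0 hr] := recession_gt phi s (recession phi s - a / c) ce.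
    by rewrite ltrBlDr ltrDl divr_gt0.
  exists (Num.max r a^-1); first by rewrite lt_max r0.
  apply: (@le_lt_trans _ _ a).
    by rewrite invf_ple ?posrE ?lt_max ?r0 // le_max lexx orbT.
  have := hr (Num.max r a^-1); rewrite le_max lexx => /(_ isT).
  have E : c * (recession phi s - a / c) = c * recession phi s - a.
    by field; rewrite gt_eqF.
  move=> h0; have h : c * (recession phi s - a / c) < c * slope phi s (Num.max r a^-1).
    by rewrite ltr_pM2l.
  rewrite E in h.
  have : c * recession phi s = 2 * a + \sum_i s ord0 i by rewrite /a; field.
  lra.
have main : \forall r \near +oo, K `<=` (fun s : 'rV[R]_n =>
    1 <= c * (phi (r *: s) - phi 0) - r * \sum_i s ord0 i).
  move/compact_near_coveringP : cK; apply => s Ks.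
  have [r r0 hr] := pt s Ks.
  have near_s : \forall s' \near s, r^-1 < c * slope phi s' r - \sum_i s' ord0 i.
    pose D := phi (r *: s + const_mx 1) - phi (r *: s).
    have D0 : 0 <= D.
      by rewrite subr_ge0; case: ce => _ hom _ _; apply: hom => i; rewrite [leRHS]mxE lerDl mxE.
    pose g := c * slope phi s r - \sum_i s ord0 i - r^-1.
    have g0 : 0 < g by rewrite subr_gt0.
    have B0 : 0 <= c * D + n%:R by rewrite addr_ge0 // mulr_ge0 // ltW.
    (* Moving [s] by less than [h] costs at most [h c D] in the slope term and [n h] in the sum;
       [h r <= 1] is required by [convex_lower_estimate]. *)
    pose h := Num.min r^-1 (g / (2 * (c * D + n%:R + 1))).
    have h0 : 0 < h by rewrite lt_min invr_gt0 r0 divr_gt0 //; lra.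
    have hr1 : h * r <= 1 by rewrite -ler_pdivlMr // mul1r ge_min lexx.
    have hg : h * (2 * (c * D + n%:R + 1)) <= g.
      by rewrite -ler_pdivlMr ?ge_min ?lexx ?orbT //; lra.
    have : nbhs s (ball s h) by exact: nbhsx_ballx.
    apply: filterS => s' [_ ss'].
    have {}ss' i : `|s ord0 i - s' ord0 i| < h by exact: ss'.
    have e01 : 0 <= h * r <= 1 by rewrite hr1 mulr_ge0 // ltW.
    have := convex_lower_estimate phi (r *: s) (r *: s') (h * r) ce e01.
    rewrite -/D => lower.
    have {}lower : phi (r *: s) - h * r * D <= phi (r *: s').
      apply: lower => i; rewrite !mxE [h * r]mulrC -mulrBr ler_pM2l //.
      by have := ss' i; rewrite ltr_norml => /andP[_]; lra.
    have sums : \sum_i s' ord0 i <= \sum_i s ord0 i + n%:R * h.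
      have -> : n%:R * h = \sum_(i < n) h by rewrite sumr_const card_ord mulr_natl.
      rewrite -big_split /=; apply: ler_sum => i _.
      by have := ss' i; rewrite ltr_norml => /andP[+ _]; lra.
    have sl : slope phi s r - h * D <= slope phi s' r.
      rewrite /slope ler_pdivlMr // mulrBl divfK ?gt_eqF //.
      by move: lower; rewrite mulrAC; lra.
    have := ler_wpM2l (ltW c0) sl; have := mulr_ge0 (ltW h0) B0.
    rewrite /g in hg; lra.
  exists ([set s' | r^-1 < c * slope phi s' r - \sum_i s' ord0 i], [set r' | r <= r']) => /=.
    by split => //; apply: nbhs_pinfty_ge; exact: num_real.
  by move=> [s' r'] /= [/ltW h rr']; exact: conv h.
apply: filterS main => r h s s1 sj sk.
by have := h s (KI s s1 sj sk).
Qed.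

(** On the boundary of a cube of radius [r] the surplus of [c (phi - phi 0)] over the sum is at
    least 1. Convexity along rays from 0 makes it at least [M / r] at maximum norm [M >= r]; inside
    the cube everything is bounded. *)
Lemma linear_growth {R : realType} {n : nat} (phi : 'rV[R]_n -> R) c :
  convex_exhaustion phi -> 0 < c ->
  dominates phi c ->
  exists2 d, 0 < d & exists C, forall (t : 'rV[R]_n) k, 0 <= t ord0 k ->
    \sum_k t ord0 k + d * \sum_k `|t ord0 k| - C <= c * phi t.
Proof.
move=> ce c0 dom; have [cvx _ _ _] := ce.
have [m0 hm0] := convex_exhaustion_bounded_below phi ce.
have facets : \forall r \near +oo, 1 <= r /\ forall j k (b : bool) (s : 'rV[R]_n),
    (forall i, `|s ord0 i| <= 1) -> s ord0 j = (-1) ^+ b -> 0 <= s ord0 k ->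
    1 <= c * (phi (r *: s) - phi 0) - r * \sum_i s ord0 i.
  near=> r; split; first by near: r; apply: nbhs_pinfty_ge; exact: num_real.
  near: r.
  do 3 (apply: filter_forall => ?); apply: facet_slope => //.
  by rewrite signr_eq0.
have /filter_ex [r [r1 hr]] := facets.
have r0 : 0 < r by lra.
(* From [sum |t_k| <= (n + 1) M]; taking [n + 1] keeps the constant positive for every [n]. *)
exists (n.+1%:R * r)^-1; first by rewrite invr_gt0 mulr_gt0.
exists (`|c * phi 0| + `|c * m0| + n.+1%:R * r + 1) => t k tk.
pose j := [arg max_(i > k) `|t ord0 i|]%O.
have jmax i : `|t ord0 i| <= `|t ord0 j|.
  by rewrite /j; case: Order.TotalTheory.arg_maxP => // i' _ /(_ i isT).
set M := `|t ord0 j| in jmax.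
have sumM : \sum_i `|t ord0 i| <= n.+1%:R * M.
  apply: (@le_trans _ _ (\sum_(i < n) M)); first by apply: ler_sum => i _; exact: jmax.
  by rewrite sumr_const card_ord -[leLHS]mulr_natl; apply: ler_wpM2r; rewrite ?ler_nat ?normr_ge0.
have S0 : 0 <= \sum_i `|t ord0 i| by apply: sumr_ge0.
have St : \sum_i t ord0 i <= \sum_i `|t ord0 i| by apply: ler_sum => i _; exact: ler_norm.
have dS : (n.+1%:R * r)^-1 * \sum_i `|t ord0 i| <= M / r.
  rewrite invfM -mulrA [r^-1 * _]mulrC mulrA ler_wpM2r ?invr_ge0 ?(ltW r0) //.
  by rewrite ler_pdivrMl.
have n1 : 0 < n.+1%:R :> R by [].
have a1 := ler_norm (c * phi 0); have a2 := ler_norm (- (c * phi 0)).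
have a3 := ler_norm (- (c * m0)).
rewrite normrN in a2; rewrite normrN in a3.
have nr : 0 < n.+1%:R * r by rewrite mulr_gt0.
have [rM|Mr] := leP r M.
- have M0 : 0 < M by exact: lt_le_trans rM.
  have tj : exists b : bool, (M^-1 *: t) ord0 j = (-1) ^+ b.
    exists (t ord0 j < 0); rewrite mxE /M.
    rewrite {2}[t ord0 j]numEsign mulrCA mulVf ?mulr1 // gt_eqF //.
  have [b sj] := tj.
  have := hr j k b (M^-1 *: t) _ sj _; rewrite !mxE mulr_ge0 ?invr_ge0 ?(ltW M0) //.
  move=> /(_ _ isT) h.
  have {h} : 1 <= c * (phi (r *: (M^-1 *: t)) - phi 0) - r * \sum_i (M^-1 *: t) ord0 i.
    apply: h => i; rewrite mxE normrM ger0_norm ?invr_ge0 ?(ltW M0) //.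
    by rewrite ler_pdivrMl // mulr1; exact: jmax.
  have -> : \sum_i (M^-1 *: t) ord0 i = M^-1 * \sum_i t ord0 i.
    by rewrite mulr_sumr; apply: eq_bigr => i _; rewrite mxE.
  have := cvx 0 t (r / M); rewrite !add0r scalerA => /(_ _) cv.
  have {cv} : phi ((r / M) *: t) <= phi 0 + r / M * (phi t - phi 0).
    by apply: cv; rewrite divr_ge0 ?(ltW r0) ?(ltW M0) //= ler_pdivrMr // mul1r.
  rewrite -(ler_pM2l c0 (phi _)) => cv h.
  have h2 : 1 <= (r / M) * (c * (phi t - phi 0) - \sum_i t ord0 i).
    have E : r * (M^-1 * \sum_i t ord0 i) = r / M * \sum_i t ord0 i by rewrite mulrA.
    rewrite E in h; move: cv h; set x := r / M; nra.
  have h3 : M / r <= c * (phi t - phi 0) - \sum_i t ord0 i.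
    have rM0 : 0 < r / M by rewrite divr_gt0.
    rewrite -(ler_pM2l rM0); apply: le_trans h2; rewrite mulrA mulfVK ?gt_eqF // divff // gt_eqF //.
  have := normr_ge0 (c * m0); move: dS h3 nr.
  set d := _^-1 * _; set y := M / r; set z := _ * r; set S := \sum_i t ord0 i; lra.
- have h1 : c * m0 <= c * phi t by rewrite ler_pM2l //; exact: hm0 tk.
  have h2 : M / r <= 1 by rewrite ler_pdivrMr // mul1r ltW.
  have h3 : n.+1%:R * M <= n.+1%:R * r by rewrite ler_pM2l // ltW.
  have := normr_ge0 (c * phi 0); move: dS h2 h3 nr sumM.
  set d := _^-1 * _; set y := M / r; set z := _ * r; set x := _ * M.
  lra.
Unshelve. all: by end_near.
Qed.

(** The bound on the recession is the growth bound at [t / s] multiplied by [s -> 0], which removes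
    [C]. The cap [d <= 1] makes [x + d |x|] nondecreasing and keeps the cube of radius [d / c]
    around [c^-1 1] in the positive orthant. *)
Lemma dominates_growth {R : realType} {n : nat} (phi : 'rV[R]_n -> R) (c : R) :
  convex_exhaustion phi -> (0 < c) -> dominates phi c ->
  exists2 d : R, (0 < d <= 1) & exists C : R, forall (t : 'rV[R]_n) k, (0 <= t ord0 k) ->
    (\sum_k t ord0 k + d * \sum_k `|t ord0 k| - C <= c * phi t) /\
    (\sum_k t ord0 k + d * \sum_k `|t ord0 k| <= c * recession phi t).
Proof.
move=> ce c0 dom; have [d0 d00 [C hC]] := linear_growth phi c ce c0 dom.
pose d : R := Num.min d0 1.
have [dd0 d1] : (d <= d0) /\ (d <= 1) by rewrite !ge_min !lexx orbT.
have d0' : (0 < d) by rewrite lt_min d00 ltr01.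
exists d; first by rewrite d0'.
have growth (t : 'rV[R]_n) k : (0 <= t ord0 k) ->
    (\sum_k t ord0 k + d * \sum_k `|t ord0 k| - C <= c * phi t).
  move=> tk; apply: le_trans (hC t k tk); rewrite lerD2r lerD2l.
  by rewrite ler_wpM2r // sumr_ge0.
exists C => t k tk; split; first exact: growth tk.
rewrite -subr_le0; apply: (@le0_of_le_mul _ _ (C + c * phi 0)) => s /andP[s0 _].
have rs0 : (0 < s^-1) by rewrite invr_gt0.
have := growth (s^-1 *: t) k; rewrite mxE mulr_ge0 ?(ltW rs0) // => /(_ isT).
have -> : (\sum_k (s^-1 *: t) ord0 k = s^-1 * \sum_k t ord0 k).
  by rewrite mulr_sumr; apply: eq_bigr => i _; rewrite mxE.
have -> : (\sum_k `|(s^-1 *: t) ord0 k| = s^-1 * \sum_k `|t ord0 k|).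
  by rewrite mulr_sumr; apply: eq_bigr => i _; rewrite mxE normrM gtr0_norm.
have := slope_le_recession phi t _ ce rs0; rewrite /slope invrK => sl.
have := ler_wpM2l (ltW c0) sl.
set p := phi (s^-1 *: t); set A := (\sum_k _); set B := (\sum_k _) => h1 h2.
have := ler_wpM2l (ltW s0) h2.
have -> : (s * (s^-1 * A + d * (s^-1 * B) - C) = A + d * B - s * C).
  by field; rewrite gt_eqF.
lra.
Qed.

(** Serves [Psi u] as [recession_shift] serves [u]: the bound for [phi] at base point [q x] and
    length [q r] is divided by [q]. *)
Lemma recession_le_shift {R : realType} {n : nat} (phi : 'rV[R]_n -> R) (s x t : 'rV[R]_n) r :
  convex_exhaustion phi -> (0 <= r) -> (forall k, s ord0 k <= (x + r *: t) ord0 k) ->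
  (recession phi s <= recession phi x + r * recession phi t).
Proof.
move=> ce r0 sx; have [_ hom _ _] := ce.
apply: ge_sup; first by case: (slope_has_sup phi s ce).
move=> _ [q /= q0 <-].
apply: (@le_trans _ _ (slope phi x q + r * recession phi t)); last first.
  by rewrite lerD2r slope_le_recession.
have h1 : (phi (q *: s) <= phi (q *: x + (q * r) *: t)).
  apply: hom => k; rewrite -scalerA -scalerDr [leLHS]mxE [leRHS]mxE.
  by rewrite ler_pM2l.
have h2 := recession_shift phi (q *: x) t (q * r) ce (mulr_ge0 (ltW q0) r0).
have -> : (slope phi x q + r * recession phi t =
  (phi (q *: x) + q * r * recession phi t - phi 0) / q).
  by rewrite /slope; field; rewrite gt_eqF.
by rewrite ler_pM2r ?invr_gt0 //; lra.
Qed.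

Lemma sum_gt0_coord {R : realType} {n : nat} (t : 'rV[R]_n) :
  0 < \sum_k t ord0 k -> exists k, 0 < t ord0 k.
Proof.
move=> st0; apply: contrapT => h; move: st0; rewrite ltNge => /negP; apply.
by apply: sumr_le0 => k _; rewrite leNgt; apply/negP => tk; apply: h; exists k.
Qed.

Local Open Scope ereal_scope.

(** * Log-convexity of toric plurisubharmonic functions *)

(** The integral is a difference of suprema over simple functions below the positive and the
    negative part, hence monotone for arbitrary functions. *)
Lemma le_integral_unmeasurable (d : measure_display) (T : measurableType d)
    (R : realType) (mu : {measure set T -> \bar R}) (D : set T)
    (f g : T -> \bar R) :
  (forall x, D x -> f x <= g x) ->
  \int[mu]_(x in D) f x <= \int[mu]_(x in D) g x.
Proof.
move=> fg.
have fgD x : (f \_ D) x <= (g \_ D) x.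
  by rewrite /patch; case: ifPn => // /set_mem /fg.
rewrite /integral; apply: leeB; apply: le_ereal_sup => _ [h hf <-];
  exists h => //= x; apply: (le_trans (hf x)).
- by apply: (@funepos_le _ _ setT) => [y _|]; rewrite ?in_setT.
- by apply: (@funeneg_le _ _ setT) => [y _|]; rewrite ?in_setT.
Qed.

Lemma usc_attains_max (T : topologicalType) (R : realType) (A : set T)
    (G : T -> \bar R) :
  compact A -> A !=set0 -> lower_semicontinuous (fun x => - G x) ->
  exists2 x, A x & forall y, A y -> G y <= G x.
Proof.
move=> cA [a0 Aa0] lscG.
have Gopen a : open [set x | G x < a].
  rewrite openE => x /= Gxa.
  have [b Gxb ba] : exists2 b : R, G x < b%:E & forall y, G y < b%:E -> G y < a.
    case: a Gxa => [a| |] Gxa.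
    - by exists a.
    - have [Gx|Gx] := eqVneq (G x) -oo.
        exists 0%R => [|y Gy]; first by rewrite Gx ltNyr.
        exact: lt_trans Gy (ltry _).
      have Gfin : G x \is a fin_num by rewrite fin_numE Gx lt_eqF.
      exists (fine (G x) + 1)%R => [|y Gy].
        by rewrite -{1}(fineK Gfin) lte_fin ltrDl.
      exact: lt_trans Gy (ltry _).
    - by rewrite ltNge leNye in Gxa.
  have [|V xV VG] := lscG x (- b)%R; first by rewrite EFinN lteN2.
  by apply: filterS xV => y /VG; rewrite EFinN lteN2; exact: ba.
apply: contrapT => nmax.
have {}nmax x : A x -> exists2 y, A y & G x < G y.
  move=> Ax; apply: contrapT => nx; apply: nmax; exists x => // y Ay.
  by rewrite leNgt; apply/negP => xy; apply: nx; exists y.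
(* Without a maximum, the open sets [G < G a] cover [A], while the superlevel sets [G >= G a] are
   directed because the order is total; compactness puts all of [A] below a value attained in
   [A]. *)
pose F : set_system T := filter_from A (fun a => [set y | A y /\ G a <= G y]).
have FF : Filter F.
  apply: filter_from_filter; first by exists a0.
  move=> i j Ai Aj; have [Gij|/ltW Gji] := leP (G i) (G j).
  - by exists j => // y [Ay jy]; split; split=> //; exact: le_trans jy.
  - by exists i => // y [Ay iy]; split; split=> //; exact: le_trans iy.
move/compact_near_coveringP : cA => /(_ T F (fun y x => G x < G y) FF) [].
- move=> x /nmax [a Aa xa].
  exists ([set x' | G x' < G a], [set y | A y /\ G a <= G y]) => /=.
    by split; [exact: open_nbhs_nbhs|exists a].
  by move=> [x' y] /= [x'a [_ ay]]; exact: lt_le_trans ay.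
- move=> a Aa /(_ a) /(_ (conj Aa (lexx _))) /(_ a Aa) /=.
  by rewrite ltxx.
Qed.

(** The remainder vanishes at 0 and has derivative [x^2 / (1 + x)], at most [2 x^2] for
    [x >= -1/2]. *)
Lemma ln1D_quadratic (R : realType) (y : R) : (`|y| <= 1 / 2 ->
  `|ln (1 + y) - y + y ^+ 2 / 2| <= 2 * `|y| ^+ 3)%R.
Proof.
move=> y2.
pose f (x : R) := (ln (1 + x) - x + x ^+ 2 / 2)%R.
have y2' : (- (1/2) <= y <= 1/2)%R by rewrite -ler_norml.
have df (x : R) : (- (1/2) <= x)%R -> is_derive x (1%R : R) f (x ^+ 2 / (1 + x))%R.
  move=> x2; have x1 : (0 < 1 + x)%R by lra.
  have dln := is_derive1_ln x1.
  apply: is_derive_eq; rewrite /GRing.scale /=; field.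
  by rewrite gt_eqF.
have cf (a b : R) : (- (1/2) <= a)%R -> {within `[a, b], continuous f}.
  move=> a2; apply: continuous_in_subspaceT => x /set_mem; rewrite /= in_itv /=.
  move=> /andP[ax _]; apply/differentiable_continuous/derivable1_diffP.
  by apply: ex_derive; apply: df; lra.
have f0 : f 0%R = 0%R by rewrite /f addr0 ln1; lra.
have bnd (c : R) : (`|c| <= `|y| -> `|c ^+ 2 / (1 + c) * y| <= 2 * `|y| ^+ 3)%R.
  move=> cy; have c2 : (- (1/2) <= c)%R.
    by have := le_trans cy y2; rewrite ler_norml => /andP[].
  rewrite normrM normf_div normrX (ger0_norm (_ : 0 <= 1 + c)%R); last by lra.
  have : (`|c| ^+ 2 / (1 + c) <= `|y| ^+ 2 * 2)%R.
    rewrite ler_pdivrMr; last by lra.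
    have : (`|c| ^+ 2 <= `|y| ^+ 2)%R by rewrite ler_sqr ?nnegrE.
    have := sqr_ge0 `|y|%R; nra.
  have := normr_ge0 y; rewrite (exprS _ 2); nra.
have [y0|y0] := leP 0%R y.
- have [x x0y||c c0y] := @MVT_segment _ f (fun x => x ^+ 2 / (1 + x))%R 0 y y0.
  + by move: x0y; rewrite in_itv /= => x0y; apply: df; lra.
  + by apply: cf; lra.
  rewrite f0 !subr0 => fE; rewrite -/(f y) fE; apply: bnd.
  by move: c0y; rewrite in_itv /= => c0y; rewrite !ger0_norm; lra.
- have [x x0y||c c0y] := @MVT_segment _ f (fun x => x ^+ 2 / (1 + x))%R y 0 (ltW y0).
  + by move: x0y; rewrite in_itv /= => x0y; apply: df; lra.
  + by apply: cf; lra.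
  rewrite f0 !sub0r mulrN => /oppr_inj fE; rewrite -/(f y).
  rewrite fE; apply: bnd.
  by move: c0y; rewrite in_itv /= => c0y; rewrite !ler0_norm; lra.
Qed.

Lemma integral_trig_quadratic (R : realType) (a b c : R) :
  \int[lebesgue_measure]_(x in `[0%R, (2 * pi)%R])
    (a + b * cos x + c * cos x ^+ 2)%:E = ((2 * pi) * (a + c / 2))%:E.
Proof.
pose F (x : R) := (a * x + b * sin x + c * (x / 2 + sin x * cos x / 2))%R.
have dF (x : R) : is_derive x (1%R : R) F (a + b * cos x + c * cos x ^+ 2)%R.
  have s1 := is_derive_sin x; have c1 := is_derive_cos x.
  apply: is_derive_eq; rewrite /GRing.scale /=.
  have -> : (sin x * - sin x = cos x ^+ 2 - 1)%R by rewrite -(cos2Dsin2 x); ring.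
  by field.
have cF : continuous F.
  by move=> x; apply/differentiable_continuous/derivable1_diffP; exact: ex_derive.
have pi2 : (0 < 2 * pi :> R)%R by rewrite mulr_gt0 ?pi_gt0.
rewrite (@continuous_FTC2 _ _ F) //.
- rewrite -EFinB /F -[(2 * pi)%R]addr0 mulrDl mul1r addr0 sinDpi sinpi sin0 cos0 oppr0.
  by congr EFin; field.
- apply: continuous_subspaceT => x.
  have cc : {for x, continuous (@cos R)} by exact: continuous_cos.
  apply: cvgD; [apply: cvgD; [exact: cvg_cst|apply: cvgM => //; exact: cvg_cst]|].
  by apply: cvgM; [exact: cvg_cst|rewrite expr2; under eq_fun do rewrite expr2; exact: cvgM].
- split.
  + by move=> x _; exact: ex_derive.
  + by apply: cvg_at_right_filter; exact: cF.
  + by apply: cvg_at_left_filter; exact: cF.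
- by move=> x _; rewrite derive1E derive_val.
Qed.

Definition logpt {R : realType} {n : nat} (t : 'rV[R]_n) : Cn R n :=
  (\row_k expR (t ord0 k), (0 : 'rV[R]_n)%R).

Lemma cabs_real {R : realType} {n : nat} (x : 'rV[R]_n) k :
  cabs ((x, 0%R) : Cn R n) k = `|x ord0 k|%R.
Proof. by rewrite /cabs /= mxE expr0n /= addr0 sqrtr_sqr. Qed.

Lemma cabs_logpt {R : realType} {n : nat} (t : 'rV[R]_n) k :
  cabs (logpt t) k = expR (t ord0 k).
Proof. by rewrite cabs_real mxE ger0_norm ?expR_ge0. Qed.

Lemma toric_eq {R : realType} {n : nat} (u : Cn R n -> \bar R) (z w : Cn R n) :
  toric u -> (forall k, cabs z k = cabs w k) -> u z = u w.
Proof.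
move=> tu zw; rewrite tu [RHS]tu; congr (u (_, _)).
by apply/rowP => k; rewrite !mxE.
Qed.

Lemma continuous_row {R : realType} (T : topologicalType) n (f : T -> 'I_n -> R) :
  (forall k, continuous (f ^~ k)) -> continuous (fun x => \row_k f x k : 'rV[R]_n).
Proof.
move=> cf x; apply/cvg_ballP => e e0.
have : \forall y \near x, forall k, ball (f x k) e (f y k).
  by apply: filter_forall => k; apply: (cvg_ball (cf k x)).
by apply: filterS => y fxy; split => // i j; rewrite !mxE.
Qed.

Lemma continuous_coord {R : realType} n (k : 'I_n) :
  continuous (fun x : 'rV[R]_n => x ord0 k).
Proof. exact: coord_continuous. Qed.

Lemma continuous_logpt {R : realType} n : continuous (@logpt R n).
Proof.
move=> t.
have c1 : {for t, continuous (fun t : 'rV[R]_n => \row_k expR (t ord0 k) : 'rV[R]_n)}.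
  apply: (@continuous_row R 'rV[R]_n n (fun t k => expR (t ord0 k))) => k x.
  by apply: (@continuous_comp _ _ _ (fun y : 'rV[R]_n => y ord0 k) expR);
    [exact: continuous_coord|exact: continuous_expR].
by apply: (cvg_pair c1 (cvg_cst (0 : 'rV[R]_n)%R)).
Qed.

Lemma lsc_comp {R : realType} (S T : topologicalType) (f : T -> \bar R) (h : S -> T) :
  lower_semicontinuous f -> continuous h -> lower_semicontinuous (f \o h).
Proof.
by move=> lf ch x a /lf [V xV Vf]; exists (h @^-1` V) => [|y /Vf //]; exact: ch.
Qed.

(** The radii of the disc are proportional to the coordinates of its centre, so the k-th modulus is
    [e^(t_k) |1 + r v_k e^(i x)|]; [|r v_k| < 1] keeps it off 0, and toricity discards the
    arguments. *)
Lemma submean_log {R : realType} {n : nat} (u : Cn R n -> \bar R)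
    (t v : 'rV[R]_n) (r : R) :
  psh u -> toric u -> (forall k, `|r * v ord0 k| < 1)%R ->
  u (logpt t) <= ((2 * pi)^-1)%:E *
     \int[lebesgue_measure]_(x in `[0%R, (2 * pi)%R])
        u (logpt (t + \row_k (ln (1 + (2 * (r * v ord0 k) * cos x + (r * v ord0 k) ^+ 2)) / 2)))%R.
Proof.
move=> [_ _ _ sub] tu rv.
have := sub (logpt t) (\row_k (r * v ord0 k * expR (t ord0 k)), (0 : 'rV[R]_n))%R.
congr (_ <= _ * _); apply: eq_integral => x _; apply: toric_eq => // k.
rewrite cabs_logpt /cabs /rotadd /= !mxE; move: (rv k).
set a := (r * v ord0 k)%R; move=> a1.
have cs := cos2Dsin2 x.
have s2 : (sin x ^+ 2 = 1 - cos x ^+ 2)%R by rewrite -cs; ring.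
have pos : (0 < 1 + (2 * a * cos x + a ^+ 2))%R.
  have -> : (1 + (2 * a * cos x + a ^+ 2) = (a + cos x) ^+ 2 + sin x ^+ 2)%R.
    by rewrite s2; ring.
  rewrite lt_neqAle addr_ge0 ?sqr_ge0 // andbT eq_sym paddr_eq0 ?sqr_ge0 //.
  apply/negP => /andP[/eqP /eqP]; rewrite !sqrf_eq0 addr_eq0 => /eqP aE /eqP s0.
  move: a1; rewrite aE normrN lt_neqAle => /andP[/negP].
  move: cs; rewrite s0 expr0n addr0 => c2; case.
  by rewrite -(@eqrXn2 _ 2) // real_normK ?num_real // c2 expr1n.
rewrite expRD -powR12_sqrt; last by rewrite addr_ge0 // sqr_ge0.
have -> : ((expR (t ord0 k) + cos x * (a * expR (t ord0 k)) - sin x * 0) ^+ 2 +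
   (0 + sin x * (a * expR (t ord0 k)) + cos x * 0) ^+ 2 =
   expR (t ord0 k) ^+ 2 * (1 + (2 * a * cos x + a ^+ 2)))%R.
  transitivity (expR (t ord0 k) ^+ 2 * (1 + 2 * a * cos x + a ^+ 2 * (cos x ^+ 2 + sin x ^+ 2)))%R.
    by ring.
  by rewrite cs; ring.
rewrite powRM ?sqr_ge0 ?(ltW pos) // powR12_sqrt ?sqr_ge0 // sqrtr_sqr.
rewrite ger0_norm ?expR_ge0 //; congr (_ * _)%R.
by rewrite /powR gt_eqF //; congr expR; ring.
Qed.

(** For [c = cos x] the factor [1 - 2 c^2] is [- cos 2x], of mean zero. With [y = 2 a c + a^2] one
    has [|y| <= 3 |a| <= 1/2]; the constant 29 is 27 from [|y|^3] plus 2 from the higher terms of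
    [y^2]. *)
Lemma ln_disc_expansion {R : realType} (a c : R) : (`|a| <= 6^-1 -> `|c| <= 1 ->
  `|ln (1 + (2 * a * c + a ^+ 2)) / 2 - a * c - a ^+ 2 / 2 * (1 - 2 * c ^+ 2)|
     <= 29 * `|a| ^+ 3)%R.
Proof.
move=> a6 c1.
set y := (2 * a * c + a ^+ 2)%R.
have a0 := normr_ge0 a.
have ya : (`|y| <= 3 * `|a|)%R.
  apply: le_trans (ler_normD _ _) _.
  have -> : (`|2 * a * c| = 2 * `|a| * `|c|)%R by rewrite !normrM (ger0_norm (_ : 0 <= 2)%R).
  rewrite normrX; nra.
have := @ln1D_quadratic R y ltac:(lra).
set k := ln _.
have y3 : (`|y| ^+ 3 <= 27 * `|a| ^+ 3)%R.
  have -> : (27 * `|a| ^+ 3 = (3 * `|a|) ^+ 3)%R by ring.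
  by apply: lerXn2r => //; rewrite nnegrE //; nra.
have -> : (k / 2 - a * c - a ^+ 2 / 2 * (1 - 2 * c ^+ 2) =
  (k - y + y ^+ 2 / 2) / 2 - (a ^+ 3 * c + a ^+ 3 * a / 4))%R.
  by rewrite /y; field.
move=> hk; apply: le_trans (ler_normB _ _) _.
rewrite normrM (ger0_norm (_ : 0 <= 2^-1)%R) //.
have : (`|a ^+ 3 * c + a ^+ 3 * a / 4| <= 2 * `|a| ^+ 3)%R.
  apply: le_trans (ler_normD _ _) _.
  rewrite normrM normrX normrM normrM normrX (ger0_norm (_ : 0 <= 4^-1)%R) //.
  have : (0 <= `|a| ^+ 3)%R by rewrite exprn_ge0.
  by nra.
by lra.
Qed.

(* Viscosity form of log-convexity. On the affine disc [z_k (1 + r v_k e^(i x))]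
   with [z = e^t], the logarithms of the moduli are [t + (r cos x) v + O(r^2)], and the
   second-order terms have mean zero; so a smooth function touching [u(e^t)] from
   above has mean [m - e r^2 / 2 + O(r^3)] on the circle, against the sub-mean
   value inequality. *)
Lemma no_concave_touching {R : realType} {n : nat} (u : Cn R n -> \bar R)
    (t v w : 'rV[R]_n) (m b e L d : R) :
  psh u -> toric u -> (0 < e)%R -> (0 <= L)%R -> (0 < d)%R ->
  u (logpt t) = m%:E ->
  (forall (x : R) (D : 'rV[R]_n), (`|x| <= d)%R -> (forall k, `|D ord0 k| <= d)%R ->
    u (logpt (t + x *: v + D)) <= (m + b * x - e * x ^+ 2 +
       L * \sum_k (2 * w ord0 k * D ord0 k + D ord0 k ^+ 2))%:E) -> False.
Proof.
move=> pu tu e0 L0 d0 um touch.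
pose V : R := (1 + \sum_k `|v ord0 k|)%R.
have Vk k : (`|v ord0 k| <= V)%R.
  rewrite /V (bigD1 k) //= addrCA lerDl addr_ge0 // sumr_ge0 //.
have V1 : (1 <= V)%R by rewrite lerDl sumr_ge0.
pose P : R := (\sum_k `|w ord0 k|)%R.
have Pk k : (`|w ord0 k| <= P)%R by rewrite /P (bigD1 k) //= lerDl sumr_ge0.
have P0 : (0 <= P)%R by rewrite sumr_ge0.
(* Cubic error with [|a| <= r V]: [2 w D] contributes [58 P |a|^3], twice the 29 of the expansion,
   and [D^2] contributes [6 |a|^3]. *)
pose Q : R := (\sum_(k < n) (58 * P + 6) * V ^+ 3)%R.
have Q0 : (0 <= Q)%R by apply: sumr_ge0 => k _; apply: mulr_ge0; [nra|rewrite exprn_ge0//; lra].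
(* Small enough for the logarithmic expansion, for the range [d] of the touching bound, and for
   [L Q r^3] to stay below [e r^2 / 2]. *)
pose r : R := (Num.min (Num.min 1 d / (6 * V)) (e / (4 * (L * Q + 1))))%R.
have LQ0 : (0 <= L * Q)%R by rewrite mulr_ge0.
have min0 : (0 < Num.min (1 : R) d)%R by rewrite lt_min ltr01 d0.
have r0 : (0 < r)%R.
  by rewrite lt_min !divr_gt0 // mulr_gt0 //; lra.
have r1 : (r * (6 * V) <= Num.min (1 : R) d)%R.
  rewrite -ler_pdivlMr; last by rewrite mulr_gt0 //; lra.
  by rewrite ge_min lexx.
have rL : (r * (4 * (L * Q + 1)) <= e)%R.
  rewrite -ler_pdivlMr; last by rewrite mulr_gt0 //; lra.
  by rewrite ge_min lexx orbT.
have [rV1 rVd] : (r * (6 * V) <= 1 /\ r * (6 * V) <= d)%R.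
  by split; apply: le_trans r1 _; rewrite ge_min lexx ?orbT.
pose W : R := (\sum_k w ord0 k * v ord0 k ^+ 2)%R.
have ak k : (`|r * v ord0 k| <= r * V)%R.
  by rewrite normrM (gtr0_norm r0) ler_pM2l.
have ak6 k : (`|r * v ord0 k| <= 6^-1)%R by have := ak k; lra.
have := @submean_log R n u t v r pu tu (fun k => ltac:(have := ak6 k; lra)).
rewrite um => /le_trans.
(* The touching bound with [D] replaced by its second-order part plus error. [W] enters through
   [1 - 2 cos^2 x] and cancels in the mean. *)
pose F (x : R) := ((m + L * (W * r ^+ 2 + Q * r ^+ 3)) + (b * r) * cos x +
   (- e * r ^+ 2 - 2 * L * W * r ^+ 2) * cos x ^+ 2)%R.
move=> /(_ ((2 * pi)^-1%:E * \int[lebesgue_measure]_(x in `[0%R, (2 * pi)%R]) (F x)%:E)).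
have pi2 : (0 < 2 * pi :> R)%R by rewrite mulr_gt0 ?pi_gt0.
have bound : ((2 * pi)^-1)%:E *
     \int[lebesgue_measure]_(x in `[0%R, (2 * pi)%R])
        u (logpt (t + \row_k (ln (1 + (2 * (r * v ord0 k) * cos x + (r * v ord0 k) ^+ 2)) / 2)))%R
  <= (2 * pi)^-1%:E * \int[lebesgue_measure]_(x in `[0%R, (2 * pi)%R]) (F x)%:E.
  apply: lee_wpmul2l; first by rewrite lee_fin invr_ge0 ltW.
  apply: le_integral_unmeasurable => x _.
  set c := cos x.
  have c1 : (`|c| <= 1)%R by rewrite ler_norml cos_geN1 cos_le1.
  pose D : 'rV[R]_n := (\row_k (ln (1 + (2 * (r * v ord0 k) * c + (r * v ord0 k) ^+ 2)) / 2
     - r * v ord0 k * c))%R.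
  have DE k : (`|D ord0 k - (r * v ord0 k) ^+ 2 / 2 * (1 - 2 * c ^+ 2)|
     <= 29 * `|r * v ord0 k| ^+ 3)%R.
    by rewrite mxE; exact: ln_disc_expansion.
  have c2 : (`|1 - 2 * c ^+ 2| <= 1)%R.
    have : (0 <= c ^+ 2 <= 1)%R.
      by rewrite sqr_ge0 /= -real_normK ?num_real // expr_le1.
    by rewrite ler_norml; lra.
  have D6 k : (`|D ord0 k| <= 6 * `|r * v ord0 k| ^+ 2)%R.
    have -> : D ord0 k = (D ord0 k - (r * v ord0 k) ^+ 2 / 2 * (1 - 2 * c ^+ 2) +
       (r * v ord0 k) ^+ 2 / 2 * (1 - 2 * c ^+ 2))%R by ring.
    apply: le_trans (ler_normD _ _) _.
    move: (DE k) (ak6 k) c2; set a := (r * v ord0 k)%R.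
    set z := (1 - _)%R => h a6 z1.
    rewrite normrM normrM normrX (ger0_norm (_ : 0 <= 2^-1)%R) //.
    have : (`|a| ^+ 3 <= `|a| ^+ 2 * 6^-1)%R.
      by rewrite exprSr ler_wpM2l // exprn_ge0.
    have : (`|a| ^+ 2 / 2 * `|z| <= `|a| ^+ 2 / 2)%R.
      by rewrite ler_piMr // mulr_ge0 // exprn_ge0.
    have := sqr_ge0 `|a|%R; lra.
  have -> : (t + \row_k (ln (1 + (2 * (r * v ord0 k) * c + (r * v ord0 k) ^+ 2)) / 2) =
     t + (r * c) *: v + D)%R.
    by apply/rowP => k; rewrite !mxE; ring.
  apply: le_trans (touch _ _ _ _) _.
  - rewrite normrM (gtr0_norm r0); nra.
  - move=> k; apply: le_trans (D6 k) _; have := ak6 k; have := ak k.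
    have := normr_ge0 (r * v ord0 k)%R; rewrite expr2; nra.
  rewrite lee_fin /F -/c.
  have : (\sum_k (2 * w ord0 k * D ord0 k + D ord0 k ^+ 2) <=
    \sum_k (w ord0 k * v ord0 k ^+ 2 * (r ^+ 2 * (1 - 2 * c ^+ 2)) +
      (58 * P + 6) * V ^+ 3 * r ^+ 3))%R.
    apply: ler_sum => k _.
    move: (DE k) (D6 k) (ak k) (ak6 k) (Pk k).
    set a := (r * v ord0 k)%R; set z := (1 - _)%R => h1 h2 h3 h4 h5.
    have a0 := normr_ge0 a.
    have a3 : (`|a| ^+ 3 <= V ^+ 3 * r ^+ 3)%R.
      by rewrite -exprMn [(V * r)%R]mulrC lerXn2r // nnegrE // (le_trans _ h3).
    have -> : (w ord0 k * v ord0 k ^+ 2 * (r ^+ 2 * z) = 2 * w ord0 k * (a ^+ 2 / 2 * z))%R.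
      by rewrite /a; field.
    have wD : (w ord0 k * (D ord0 k - a ^+ 2 / 2 * z) <= P * (29 * `|a| ^+ 3))%R.
      apply: le_trans (ler_norm _) _; rewrite normrM; exact: ler_pM.
    have DD : (D ord0 k ^+ 2 <= 6 * `|a| ^+ 3)%R.
      rewrite -real_normK ?num_real //.
      apply: (@le_trans _ _ ((6 * `|a| ^+ 2) ^+ 2)%R).
        by rewrite ler_sqr ?nnegrE // mulr_ge0 // exprn_ge0.
      have -> : ((6 * `|a| ^+ 2) ^+ 2 = 6 * (`|a| ^+ 3 * (6 * `|a|)))%R by ring.
      rewrite ler_pM2l // ler_piMr // ?exprn_ge0 //; lra.
    nra.
  rewrite [X in (_ <= X)%R]big_split /= -[X in (_ <= X + _)%R]mulr_suml.
  rewrite -[X in (_ <= _ + X)%R]mulr_suml -/W -/Q => hs.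
  have := ler_wpM2l L0 hs; lra.
move=> /(_ bound); rewrite integral_trig_quadratic -EFinM lee_fin mulrA mulVf ?gt_eqF //.
rewrite mul1r leNgt => /negP; apply.
rewrite -subr_gt0.
have -> : (m - (m + L * (W * r ^+ 2 + Q * r ^+ 3) + (- e * r ^+ 2 - 2 * L * W * r ^+ 2) / 2)
  = r ^+ 2 * (e / 2 - (L * Q) * r))%R by field.
apply: mulr_gt0; first by rewrite exprn_gt0.
nra.
Qed.

Lemma lsc_subr_cont {R : realType} (T : topologicalType) (f : T -> \bar R) (q : T -> R) :
  (forall x, f x != +oo) ->
  lower_semicontinuous (fun x => - f x) -> continuous q ->
  lower_semicontinuous (fun x => - (f x + (q x)%:E)).
Proof.
move=> fy lf cq x a; rewrite -lteN2 oppeK -EFinN => fqa.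
have [b [fb ba]] : exists b : R, f x < b%:E /\ (b < - a - q x)%R.
  move: (fy x) fqa; case: (f x) => [r _|//|_ _].
  - rewrite lte_fin => h; exists ((r + (- a - q x)) / 2)%R.
    by rewrite lte_fin; split; lra.
  - by exists (- a - q x - 1)%R; rewrite ltNyr; split => //; lra.
have [|V xV Vb] := lf x (- b)%R; first by rewrite EFinN lteN2.
have h : (0 < - a - q x - b)%R by lra.
have qn : \forall y \near x, (`|q x - q y| < - a - q x - b)%R.
  by move/cvgrPdist_lt : (cq x); apply.
exists [set y | V y /\ (`|q x - q y| < - a - q x - b)%R]; first exact: filterI.
move=> y [/Vb + qy]; rewrite EFinN lteN2 => fyb.
rewrite -lteN2 oppeK -EFinN.
have qy' : (q y < - a - b)%R by move: qy; rewrite ltr_norml => /andP[? ?]; lra.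
move: (fy y) fyb; case: (f y) => [r _|//|_ _]; last by rewrite ltNyr.
rewrite -EFinD !lte_fin; lra.
Qed.

Lemma compact_rV_box {R : realType} n (e : R) :
  compact [set w : 'rV[R]_n | forall k, (`|w ord0 k| <= e)%R].
Proof.
rewrite (_ : [set w | _] = [set w : 'rV[R]_n | forall k, `[(- e)%R, e]%classic (w ord0 k)]).
  by apply: (@rV_compact R n (fun=> `[(- e)%R, e]%classic)) => k; exact: segment_compact.
by apply/seteqP; split => w /= wk k; have := wk k; rewrite /= in_itv /= ler_norml.
Qed.

(* If convexity fails, maximize [u(e^(p + s v + w)) - l(s) + e s^2 - L |w|^2], [l] the
   affine bound, over the cylinder [0 <= s <= 1], [|w_k| <= rho]: for small [rho] and
   large [L] the maximum is interior, where [no_concave_touching] applies. *)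
Lemma psh_log_convex {R : realType} {n : nat} (u : Cn R n -> \bar R)
    (p v : 'rV[R]_n) (A B s1 : R) :
  psh u -> toric u -> u (logpt p) <= A%:E -> u (logpt (p + v)%R) <= B%:E ->
  (0 <= s1 <= 1)%R -> u (logpt (p + s1 *: v)%R) <= (A + s1 * (B - A))%:E.
Proof.
move=> pu tu uA uB s01; have [uy _ lscu _] := pu.
rewrite leNgt; apply/negP => gap.
have [m um gapm] : exists2 m : R, u (logpt (p + s1 *: v)%R) = m%:E & (A + s1 * (B - A) < m)%R.
  move: gap (uy (logpt (p + s1 *: v)%R)); case: (u _) => // m.
  by rewrite lte_fin => h _; exists m.
(* A third of the gap: near the ends semicontinuity costs one [e] and the term [e s^2] at most
   another, so the penalized value stays below [3 e] there. *)
pose e : R := ((m - (A + s1 * (B - A))) / 3)%R.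
have e0 : (0 < e)%R by rewrite divr_gt0 // subr_gt0.
pose U (t : 'rV[R]_n) := u (logpt t).
have lscU : lower_semicontinuous (fun t => - U t).
  by apply: (@lsc_comp _ _ _ (fun z => - u z) logpt) => //; exact: continuous_logpt.
have ends (t : 'rV[R]_n) (C : R) : U t <= C%:E ->
    \forall w \near (0 : 'rV[R]_n)%R, U (t + w)%R < (C + e)%:E.
  move=> UC; have [|V tV VU] := lscU t (- (C + e))%R.
    by rewrite EFinN lteN2; apply: le_lt_trans UC _; rewrite lte_fin ltrDl.
  have ct : continuous (fun w : 'rV[R]_n => t + w)%R.
    by move=> w; apply: (@cvgD R 'rV[R]_n _ (nbhs w) _ (fun=> t) id);
      [exact: cvg_cst|exact: cvg_id].
  have : \forall w \near (0 : 'rV[R]_n)%R, V (t + w)%R.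
    by apply: (ct 0%R); rewrite addr0.
  by apply: filterS => w /VU; rewrite EFinN lteN2.
have [rho rho0 [endA endB]] : exists2 rho : R, (0 < rho)%R &
    (forall w : 'rV[R]_n, (forall k, `|w ord0 k| <= rho)%R -> U (p + w)%R < (A + e)%:E) /\
    (forall w : 'rV[R]_n, (forall k, `|w ord0 k| <= rho)%R -> U (p + v + w)%R < (B + e)%:E).
  have : nbhs (0 : 'rV[R]_n)%R
      [set w : 'rV[R]_n | U (p + w)%R < (A + e)%:E /\ U (p + v + w)%R < (B + e)%:E].
    exact: filterI (ends p A uA) (ends (p + v)%R B uB).
  move/nbhs_ballP => [d /= d0 hd].
  exists (d / 2)%R; first by rewrite divr_gt0.
  have bd (w : 'rV[R]_n) : (forall k, `|w ord0 k| <= d / 2)%R -> ball (0 : 'rV[R]_n)%R d w.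
    move=> wk; split => // i k; rewrite /ball /= mxE sub0r normrN (ord1 i).
    by apply: le_lt_trans (wk k) _; rewrite ltr_pdivrMr // mulr_natr mulr2n ltrDl.
  by split=> w /bd /hd [].
pose box : set (R * 'rV[R]_n) :=
  `[0%R, 1%R]%classic `*` [set w : 'rV[R]_n | forall k, (`|w ord0 k| <= rho)%R].
have cbox : compact box.
  by apply: compact_setX; [exact: segment_compact|exact: compact_rV_box].
have box1 : box (s1, 0%R).
  split => /=; first by rewrite in_itv.
  by move=> k; rewrite mxE normr0 ltW.
pose f (x : R * 'rV[R]_n) := U (p + x.1 *: v + x.2)%R.
have fy x : f x != +oo by exact: uy.
have cline : continuous (fun x : R * 'rV[R]_n => p + x.1 *: v + x.2)%R.
  move=> x; apply: (@cvgD R 'rV[R]_n _ (nbhs x) _ (fun x => p + x.1 *: v)%R snd);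
    last exact: cvg_snd.
  apply: (@cvgD R 'rV[R]_n _ (nbhs x) _ (fun=> p) (fun x => x.1 *: v)%R); first exact: cvg_cst.
  by apply: (@cvgZr_tmp R 'rV[R]_n _ (nbhs x) _ fst); exact: cvg_fst.
have lscf : lower_semicontinuous (fun x => - f x).
  exact: (@lsc_comp R _ _ (fun t => - U t) _ lscU cline).
have [x1 bx1 fmax] := usc_attains_max _ _ _ _ cbox (ex_intro _ _ box1) lscf.
have [M fM] : exists M : R, forall x, box x -> f x <= M%:E.
  have := fmax _ box1; rewrite {1}/f /= addr0 /U um.
  by case: (f x1) (fy x1) fmax => // M _ fM _; exists M.
(* On the side [|w_k| = rho] the penalty then outweighs all other terms, and the penalized value is
   at most 0. *)
pose L : R := ((`|M| + `|A| + `|B| + e) / rho ^+ 2)%R.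
have L0 : (0 <= L)%R.
  by rewrite divr_ge0 ?sqr_ge0 // !addr_ge0 // ltW.
pose q (x : R * 'rV[R]_n) : R :=
  (- (A + x.1 * (B - A)) + e * x.1 ^+ 2 - L * \sum_k (x.2 ord0 k) ^+ 2)%R.
have cq : continuous q.
  have c1 : continuous (fun x : R * 'rV[R]_n => x.1) by move=> x; exact: cvg_fst.
  have c2 k : continuous (fun x : R * 'rV[R]_n => x.2 ord0 k).
    move=> x; apply: (@continuous_comp _ _ _ snd (fun y : 'rV[R]_n => y ord0 k)).
      exact: cvg_snd.
    exact: coord_continuous.
  have cs : continuous (fun x : R * 'rV[R]_n => \sum_k x.2 ord0 k ^+ 2)%R.
    apply: continuous_big => [|k _ x]; first exact: add_continuous.
    exact: (cvgM (c2 k x) (c2 k x)).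
  move=> x; exact: (cvgB (cvgD (cvgN (cvgD (cvg_cst A) (cvgM (c1 x) (cvg_cst (B - A)%R))))
    (cvgM (cvg_cst e) (cvgM (c1 x) (c1 x)))) (cvgM (cvg_cst L) (cs x))).
pose G x := f x + (q x)%:E.
have lscG : lower_semicontinuous (fun x => - G x) by exact: lsc_subr_cont.
have [[s0 w0] [/= s0I w0I] Gmax] := usc_attains_max _ _ _ _ cbox (ex_intro _ _ box1) lscG.
have sum0 (w : 'rV[R]_n) : (0 <= \sum_k (w ord0 k) ^+ 2)%R.
  by apply: sumr_ge0 => k _; exact: sqr_ge0.
have G1 : (3 * e)%:E <= G (s0, w0).
  apply: le_trans (Gmax _ box1); rewrite /G /f /q /= addr0 /U um -EFinD lee_fin.
  rewrite big1 => [|k _]; last by rewrite mxE expr0n.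
  have := sqr_ge0 s1; have -> : (3 * e = m - (A + s1 * (B - A)))%R by rewrite /e; field.
  nra.
have [m0 um0] : exists m0 : R, f (s0, w0) = m0%:E.
  by move: (fy (s0, w0)) G1; rewrite /G; case: (f _) => // m0 _ _; exists m0.
have {}G1 : (3 * e <= m0 + q (s0, w0))%R by rewrite -lee_fin EFinD -um0.
move: s0I; rewrite in_itv /= => /andP[s00 s01'].
have s0gt : (0 < s0)%R.
  rewrite lt_neqAle s00 andbT; apply/eqP => s0E.
  have := endA _ w0I; move: um0 G1; rewrite /f /q /= -s0E scale0r addr0 => ->.
  rewrite lte_fin; have := mulr_ge0 L0 (sum0 w0); nra.
have s0lt : (s0 < 1)%R.
  rewrite lt_neqAle s01' andbT; apply/eqP => s0E.
  have := endB _ w0I; move: um0 G1; rewrite /f /q /= s0E scale1r => ->.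
  rewrite lte_fin; have := mulr_ge0 L0 (sum0 w0); nra.
have w0lt k : (`|w0 ord0 k| < rho)%R.
  rewrite lt_neqAle w0I andbT; apply/eqP => wE.
  have : f (s0, w0) <= M%:E by apply: fM; split => //=; rewrite in_itv /= s00.
  rewrite um0 lee_fin => mM.
  have : (L * rho ^+ 2 <= L * \sum_k (w0 ord0 k) ^+ 2)%R.
    apply: ler_wpM2l => //; rewrite (bigD1 k) //= -wE real_normK ?num_real // lerDl.
    by apply: sumr_ge0 => j _; exact: sqr_ge0.
  rewrite {1}/L mulfVK; last by rewrite expf_neq0 // gt_eqF.
  move: G1; rewrite /q /=.
  have := ler_norm M; have := ler_norm (- A)%R; have := ler_norm (- B)%R; rewrite !normrN.
  have : (s0 ^+ 2 <= 1)%R by rewrite expr_le1.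
  have := normr_ge0 A; have := normr_ge0 B.
  nra.
have [d d0 [ds0 ds1 dw]] : exists2 d : R, (0 < d)%R &
    [/\ (d <= s0)%R, (d <= 1 - s0)%R & forall k, (`|w0 ord0 k| + d <= rho)%R].
  have : \forall d \near 0%R^'+, [/\ (0 < d)%R, (d <= s0)%R, (d <= 1 - s0)%R &
      forall k, (d <= rho - `|w0 ord0 k|)%R].
    near=> d; split; near: d.
    - exact: nbhs_right_gt.
    - exact: nbhs_right_le.
    - by apply: nbhs_right_le; rewrite subr_gt0.
    - by apply: filter_forall => k; apply: nbhs_right_le; rewrite subr_gt0.
  move=> /filter_ex [d [d0 ds0 ds1 dw]]; exists d => //; split => // k.
  by have := dw k; lra.
(* Maximality becomes a touching bound: expanding [e s^2] at [s0] gives the slope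
   [(B - A) - 2 e s0], and the increment of [L |w|^2] at [w0] gives the terms in [D]. *)
apply: (@no_concave_touching R n u (p + s0 *: v + w0)%R v w0 m0
          ((B - A) - 2 * e * s0)%R e L d) => // x D xd Dd.
have xD : box (s0 + x, w0 + D)%R.
  move: xd; rewrite ler_norml => /andP[xd1 xd2].
  split => /=; first by rewrite in_itv /=; apply/andP; split; lra.
  move=> k; rewrite mxE; apply: le_trans (ler_normD _ _) _.
  by apply: le_trans (dw k); rewrite lerD2l.
have := Gmax _ xD; rewrite /G um0 -EFinD.
have -> : f (s0 + x, w0 + D)%R = u (logpt (p + s0 *: v + w0 + x *: v + D)%R).
  rewrite /f /U /=; congr (u (logpt _)).
  by rewrite scalerDl !addrA; congr (_ + _)%R; rewrite addrAC.
move: (uy (logpt (p + s0 *: v + w0 + x *: v + D)%R)); case: (u _) => [y _|//|_ _];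
  last by rewrite leNye.
rewrite -EFinD !lee_fin /q /= => h.
have : (L * \sum_k ((w0 + D) ord0 k) ^+ 2 = L * \sum_k (w0 ord0 k) ^+ 2 +
   L * \sum_k (2 * w0 ord0 k * D ord0 k + D ord0 k ^+ 2))%R.
  rewrite -mulrDr -big_split /=; congr (_ * _)%R; apply: eq_bigr => k _.
  by rewrite mxE; ring.
nra.
Unshelve. all: by end_near.
Qed.

(** * Finiteness, monotonicity and growth of the logarithmic profile *)

Definition log_profile {R : realType} {n : nat} (u : Cn R n -> \bar R)
    (t : 'rV[R]_n) : R := fine (u (logpt t)).

Lemma expR_le_cnorm {R : realType} {n : nat} (t : 'rV[R]_n) k :
  (expR (t ord0 k) <= cnorm (logpt t))%R.
Proof.
rewrite /cnorm -[leLHS]ger0_norm ?expR_ge0 // -sqrtr_sqr ler_sqrt; last first.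
  by apply: sumr_ge0 => j _; rewrite addr_ge0 ?sqr_ge0.
rewrite (bigD1 k) //= !mxE expr0n /= addr0 lerDl.
by apply: sumr_ge0 => j _; rewrite addr_ge0 ?sqr_ge0.
Qed.

Lemma LPSHstar_log_lower {R : realType} {n : nat} (u : Cn R n -> \bar R) (M : R) :
  LPSHstar u -> exists T : R, forall (t : 'rV[R]_n) k,
    (T <= t ord0 k)%R -> M%:E < u (logpt t).
Proof.
move=> [_ /(_ M) [r0 ur0]]; exists r0 => t k tk; apply: ur0.
apply: lt_le_trans (expR_le_cnorm t k).
apply: (@lt_le_trans _ _ (expR r0)); last by rewrite ler_expR.
by apply: lt_le_trans (expR_ge1Dx _); rewrite ltrDr.
Qed.

(** If [u] were [-oo] at [t], convexity would push the midpoint of a segment from [t] below any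
    bound; the segment is chosen with its midpoint at a far diagonal point, where [u > 0]. *)
Lemma log_profileE {R : realType} {n : nat} (u : Cn R n -> \bar R) (t : 'rV[R]_n) :
  (0 < n)%N -> LPSHstar u -> toric u -> u (logpt t) = (log_profile u t)%:E.
Proof.
move=> n0 su tu; rewrite /log_profile fineK // fin_numE.
have [[pu _] _] := su; have [uy _ _ _] := pu; rewrite uy andbT.
apply/eqP => ut.
have [T uT] := LPSHstar_log_lower u 0 su.
pose t1 : 'rV[R]_n := const_mx T.
have := uT t1 (Ordinal n0); rewrite mxE lexx => /(_ isT).
have [B uB] : exists B : R, u (logpt (t + (2 *: (t1 - t)))%R) <= B%:E.
  move: (uy (logpt (t + (2 *: (t1 - t)))%R)); case: (u _) => // [r _|_].
  - by exists r.
  - by exists 0%R; rewrite leNye.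
have utB : u (logpt t) <= (- B)%:E by rewrite ut leNye.
have := @psh_log_convex R n u t _ _ _ (2^-1)%R pu tu utB uB ltac:(lra).
rewrite scalerA mulVf // scale1r subrKC.
have -> : (- B + 2^-1 * (B - - B) = 0)%R by field.
by move=> h1 h2; have := lt_le_trans h2 h1; rewrite ltxx.
Qed.

Lemma log_profile_convex {R : realType} {n : nat} (u : Cn R n -> \bar R)
    (p v : 'rV[R]_n) (s : R) :
  (0 < n)%N -> LPSHstar u -> toric u -> (0 <= s <= 1)%R ->
  (log_profile u (p + s *: v) <=
   log_profile u p + s * (log_profile u (p + v) - log_profile u p))%R.
Proof.
move=> n0 su tu s01; rewrite -lee_fin -log_profileE //.
by apply: psh_log_convex => //; rewrite ?log_profileE //; case: su => [[]].
Qed.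

(** Points with zero coordinates are included, so the profile is bounded above as coordinates tend
    to [-oo]; monotonicity rests on this. *)
Lemma psh_bounded_box {R : realType} {n : nat} (u : Cn R n -> \bar R) (e : R) :
  psh u -> (0 <= e)%R -> exists M : R, forall x : 'rV[R]_n,
    (forall k, `|x ord0 k| <= e)%R -> u (x, 0%R) <= M%:E.
Proof.
move=> [uy _ lscu _] e0.
have ci : continuous (fun x : 'rV[R]_n => (x, 0%R) : Cn R n).
  move=> x; have c1 : {for x, continuous (fun y : 'rV[R]_n => y)} by exact: cvg_id.
  by apply: (cvg_pair c1 (cvg_cst (0 : 'rV[R]_n)%R)).
have lsc1 := @lsc_comp R _ _ (fun z => - u z) _ lscu ci.
have [|x _ xmax] := usc_attains_max _ _ _ (fun x => u (x, 0%R)) (compact_rV_box n e) _ lsc1.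
  by exists 0%R => k; rewrite mxE normr0.
have [M uM] : exists M : R, u (x, 0%R) <= M%:E.
  move: (uy (x, 0%R)); case: (u _) => // [r _|_]; first by exists r.
  by exists 0%R; rewrite leNye.
by exists M => y /xmax /le_trans; apply.
Qed.

(* A convex function bounded above in the direction [-v] is nondecreasing along [v]. *)
Lemma log_profile_homo {R : realType} {n : nat} (u : Cn R n -> \bar R)
    (t t' : 'rV[R]_n) :
  (0 < n)%N -> LPSHstar u -> toric u ->
  (forall k, t ord0 k <= t' ord0 k)%R -> (log_profile u t <= log_profile u t')%R.
Proof.
move=> n0 su tu tt'; have [[pu _] _] := su.
pose e := (\sum_k expR (t ord0 k))%R.
have e0 : (0 <= e)%R by apply: sumr_ge0 => k _; exact: expR_ge0.
have [M uM] := psh_bounded_box u e pu e0.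
pose v := (t' - t)%R.
(* With [q = t - N v], [t] lies at fraction [N / (N + 1)] of the segment from [q] to [t'], and the
   profile at [q] is at most [M] for every [N]. *)
have ineq (N : nat) : (log_profile u t - log_profile u t' <=
    (M - log_profile u t') / N.+1%:R)%R.
  pose q := (t - N%:R *: v)%R.
  have qM : (log_profile u q <= M)%R.
    rewrite -lee_fin -log_profileE //; apply: uM => k.
    rewrite mxE ger0_norm ?expR_ge0 // /e (bigD1 k) //=.
    apply: ler_wpDr; first by apply: sumr_ge0 => j _; exact: expR_ge0.
    rewrite ler_expR !mxE gerBl mulr_ge0 // subr_ge0; exact: tt'.
  have N1 : (0 < N.+1%:R :> R)%R by [].
  have s01 : (0 <= (N%:R / N.+1%:R : R) <= 1)%R.
    by rewrite divr_ge0 //= ler_pdivrMr // mul1r ler_nat.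
  have := @log_profile_convex R n u q (N.+1%:R *: v) (N%:R / N.+1%:R)%R n0 su tu s01.
  rewrite scalerA mulfVK ?gt_eqF // subrK.
  have -> : (q + N.+1%:R *: v = t')%R.
    by apply/rowP => k; rewrite !mxE -natr1; ring.
  move=> h; apply: le_trans (lerB h (lexx _)) _.
  have -> : (N%:R / N.+1%:R = 1 - N.+1%:R^-1 :> R)%R.
    by rewrite -natr1; field; rewrite natr1 gt_eqF.
  rewrite -subr_ge0.
  have -> : ((M - log_profile u t') / N.+1%:R - (log_profile u q +
     (1 - N.+1%:R^-1) * (log_profile u t' - log_profile u q) - log_profile u t') =
     (M - log_profile u q) / N.+1%:R)%R by ring.
  by rewrite divr_ge0 // subr_ge0.
rewrite leNgt; apply/negP => lt.
have d0 : (0 < log_profile u t - log_profile u t')%R by rewrite subr_gt0.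
have [N hN] : exists N : nat,
    (`|M - log_profile u t'| / (log_profile u t - log_profile u t') < N.+1%:R)%R.
  exists (Num.truncn (`|M - log_profile u t'| / (log_profile u t - log_profile u t'))%R).
  exact: truncnS_gt.
have := ineq N; rewrite ler_pdivlMr // leNgt => /negP; apply.
rewrite ltr_pdivrMr // in hN; rewrite mulrC; apply: le_lt_trans hN; exact: ler_norm.
Qed.

(** Nonzero moduli are raised by monotonicity. Zero coordinates have no logarithm: they are replaced
    by circles of radius [e^(t_k)], on which [u] is constant by toricity, and the sub-mean
    inequality concludes. *)
Lemma polydisk_sup {R : realType} {n : nat} (u : Cn R n -> \bar R)
    (t : 'rV[R]_n) (w : Cn R n) :
  (0 < n)%N -> LPSHstar u -> toric u ->
  (forall k, cabs w k <= expR (t ord0 k))%R -> u w <= (log_profile u t)%:E.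
Proof.
move=> n0 su tu wt; have [[[_ _ _ sub] _] _] := su.
pose s : 'rV[R]_n := \row_k (if cabs w k == 0%R then t ord0 k else ln (cabs w k)).
have cw0 k : (0 <= cabs w k)%R by exact: sqrtr_ge0.
have cw k : cabs w k != 0%R -> (0 < cabs w k)%R by rewrite lt_neqAle eq_sym cw0 andbT.
apply: (@le_trans _ _ (log_profile u s)%:E); last first.
  rewrite lee_fin; apply: log_profile_homo => // k; rewrite mxE; case: ifPn => // /cw wk.
  by rewrite -[leRHS]expRK ler_ln // ?posrE ?expR_gt0.
rewrite tu.
pose b : Cn R n := (\row_k (if cabs w k == 0 then expR (t ord0 k) else 0), 0)%R.
apply: le_trans (sub _ b) _.
have -> : \int[lebesgue_measure]_(x in `[0%R, (2 * pi)%R]) u (rotadd (modpt w) b x) =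
   \int[lebesgue_measure]_(x in `[0%R, (2 * pi)%R])
     (log_profile u s + 0 * cos x + 0 * cos x ^+ 2)%:E.
  apply: eq_integral => x _; rewrite !mul0r !addr0 -log_profileE //.
  apply: toric_eq => // k; rewrite cabs_logpt /cabs /rotadd /= !mxE -/(cabs w k).
  case: ifPn => [/eqP ->|/[dup] /cw wk _].
    rewrite [X in Num.sqrt X](_ : _ = expR (t ord0 k) ^+ 2)%R.
      by rewrite sqrtr_sqr ger0_norm // expR_ge0.
    transitivity (expR (t ord0 k) ^+ 2 * (cos x ^+ 2 + sin x ^+ 2))%R; first by ring.
    by rewrite cos2Dsin2 mulr1.
  rewrite lnK ?posrE // !mulr0 !subr0 !addr0 expr0n addr0 sqrtr_sqr ger0_norm //.
rewrite integral_trig_quadratic mul0r addr0 -EFinM mulrA mulVf ?mul1r //.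
by rewrite gt_eqF // mulr_gt0 // pi_gt0.
Qed.

Lemma log_profile_lower {R : realType} {n : nat} (u : Cn R n -> \bar R) (M : R) :
  (0 < n)%N -> LPSHstar u -> toric u ->
  exists T : R, forall (t : 'rV[R]_n) k, (T <= t ord0 k)%R -> (M < log_profile u t)%R.
Proof.
move=> n0 su tu; have [T uT] := LPSHstar_log_lower u M su.
by exists T => t k /uT; rewrite log_profileE.
Qed.

Lemma log_profile_upper {R : realType} {n : nat} (u : Cn R n -> \bar R) :
  (0 < n)%N -> LPSHstar u -> toric u ->
  exists C T : R, forall m : R, (T <= m)%R -> (log_profile u (const_mx m) <= C * m)%R.
Proof.
move=> n0 su tu; have [[_ [C [r0 ur0]]] _] := su.
exists (2 * `|C|)%R, (1 + `|r0| + `|ln n%:R|)%R => m Tm.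
have m0 : (0 <= m)%R.
  by apply: le_trans Tm; rewrite !addr_ge0.
have cm : (expR m <= cnorm (logpt (const_mx m : 'rV[R]_n)))%R.
  by have := expR_le_cnorm (const_mx m : 'rV[R]_n) (Ordinal n0); rewrite mxE.
have cn : (cnorm (logpt (const_mx m : 'rV[R]_n)) <= n%:R * expR m)%R.
  rewrite -[leRHS]ger0_norm; last by rewrite mulr_ge0 ?expR_ge0.
  rewrite -sqrtr_sqr ler_sqrt ?sqr_ge0 //.
  under eq_bigr do rewrite !mxE expr0n addr0.
  rewrite sumr_const card_ord -[leLHS]mulr_natl exprMn ler_wpM2r ?sqr_ge0 //.
  by rewrite -natrX ler_nat leq_pmulr.
rewrite -lee_fin -log_profileE //; apply: le_trans (ur0 _ _) _.
  apply: lt_le_trans cm; apply: lt_le_trans (expR_ge1Dx _).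
  have := ler_norm r0; have := normr_ge0 (ln (n%:R : R)); lra.
have cpos : (0 < cnorm (logpt (const_mx m : 'rV[R]_n)))%R.
  by apply: lt_le_trans cm; exact: expR_gt0.
have l1 : (m <= ln (cnorm (logpt (const_mx m : 'rV[R]_n))))%R.
  by rewrite -[leLHS]expRK ler_ln // ?posrE ?expR_gt0.
have l2 : (ln (cnorm (logpt (const_mx m : 'rV[R]_n))) <= ln n%:R + m)%R.
  rewrite -[X in (_ <= _ + X)%R]expRK -lnM ?posrE ?expR_gt0 ?ltr0n //.
  by rewrite ler_ln // posrE mulr_gt0 ?expR_gt0 ?ltr0n.
rewrite lee_fin.
have := ler_norm C; have := ler_norm (ln (n%:R : R)); have := normr_ge0 r0.
have := normr_ge0 C.
nra.
Qed.

(** * Iterated integrals *)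

Lemma le_iter_int {R : realType} m (f g : (nat -> R) -> \bar R) :
  (forall s, f s <= g s) -> iter_int m f <= iter_int m g.
Proof.
elim: m f g => [|m ih] f g fg /=; first exact: fg.
by apply: le_integral_unmeasurable => t _; apply: ih => s; exact: fg.
Qed.

Lemma eq_iter_int {R : realType} m (f g : (nat -> R) -> \bar R) :
  (forall s, f s = g s) -> iter_int m f = iter_int m g.
Proof. by move=> /funext ->. Qed.

(** Sums of products are the only integrands on C^n whose iterated integral is evaluated; both
    integral criteria compare with them. *)
Lemma iter_int_sum_prod {R : realType} m (I : Type) (r : seq I) (a : I -> \bar R)
    (h : I -> nat -> R -> \bar R) :
  (forall i, 0 <= a i) -> (forall i j x, 0 <= h i j x) ->
  (forall i j, measurable_fun [set: R] (h i j)) ->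
  iter_int m (fun s => \sum_(i <- r) a i * \big[*%E/1]_(j < m) h i j (s j)) =
  \sum_(i <- r) a i * \big[*%E/1]_(j < m) \int[lebesgue_measure]_x h i j x.
Proof.
move=> + h0 mh; elim: m a => [|m ih] a a0 /=.
  by apply: eq_bigr => i _; rewrite !big_ord0.
have int0 i j : 0 <= \int[lebesgue_measure]_x h i j x by exact: integral_ge0.
have prod0 k i : 0 <= \big[*%E/1]_(j < k) \int[lebesgue_measure]_x h i j x.
  by elim/big_ind : _ => // x y; exact: mule_ge0.
transitivity (\int[lebesgue_measure]_t \sum_(i <- r)
    (a i * \big[*%E/1]_(j < m) \int[lebesgue_measure]_x h i j x) * h i m t).
  apply: eq_integral => t _.
  transitivity (iter_int m (fun s =>
      \sum_(i <- r) (a i * h i m t) * \big[*%E/1]_(j < m) h i j (s j))).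
    apply: eq_iter_int => s; apply: eq_bigr => i _.
    rewrite big_ord_recr /= eqxx [X in _ * X]muleC muleA.
    congr (_ * _); apply: eq_bigr => j _.
    by rewrite ltn_eqF.
  rewrite ih => [|i]; last exact: mule_ge0.
  by apply: eq_bigr => i _; rewrite muleAC.
rewrite ge0_integral_sum //.
- apply: eq_bigr => i' _; rewrite ge0_integralZl //.
  + by rewrite big_ord_recr /= muleA.
  + exact: mh.
  + exact: mule_ge0.
- by move=> i; apply: measurable_funeM; exact: mh.
- by move=> i x _; rewrite !mule_ge0.
Qed.

Lemma big_ord_double {R : realType} n (F : nat -> \bar R) :
  \big[*%E/1]_(j < 2 * n) F j =
  (\big[*%E/1]_(k < n) F k) * \big[*%E/1]_(k < n) F (n + k)%N.
Proof. by rewrite -(big_mkord xpredT F) mul2n -addnn big_mkord big_split_ord. Qed.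

(* With [s = ln |x|] this is [e^(- s) / (e^(d s) + e^(- d s))], comparable to
   [e^(- s - d |s|)]; for [x > 0] its antiderivative is [atan (e^(d s)) / d]. *)
Definition tail_density {R : realType} (d x : R) : R :=
  (`|x|^-1 * (expR (d / 2 * ln (x ^+ 2)) / (1 + expR (d * ln (x ^+ 2)))))%R.

Lemma continuous_tail_density {R : realType} (d x : R) : x != 0%R ->
  {for x, continuous (tail_density d)}.
Proof.
move=> x0.
have x2 : (0 < x ^+ 2)%R by rewrite exprn_even_gt0.
have cl : {for x, continuous (fun x : R => ln (x ^+ 2))}.
  apply: (@continuous_comp _ _ _ (fun x : R => x ^+ 2)%R (@ln R)); first exact: exprn_continuous.
  exact: continuous_ln.
have ce (a : R) : {for x, continuous (fun x : R => expR (a * ln (x ^+ 2)))%R}.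
  apply: (@continuous_comp _ _ _ (fun x : R => a * ln (x ^+ 2))%R expR).
    by apply: cvgM; [exact: cvg_cst|exact: cl].
  exact: continuous_expR.
apply: cvgM.
  by apply: cvgV; [rewrite normr_eq0|exact: norm_continuous].
apply: cvgM; first exact: ce.
apply: cvgV; last by apply: cvgD; [exact: cvg_cst|exact: ce].
by rewrite gt_eqF // addr_gt0 // expR_gt0.
Qed.

(** The bound does not depend on the interval because the antiderivative is bounded; [sg] is the
    sign of the interval and makes the formula for [x > 0] serve [x < 0] too. *)
Lemma tail_density_integral_itv {R : realType} (d a b : R) : (0 < d)%R -> (a < b)%R ->
  (0 < a \/ b < 0)%R ->
  \int[lebesgue_measure]_(x in `[a, b]) (tail_density d x)%:E <= (pi / d)%:E.
Proof.
move=> d0 ab ab0.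
have nz x : (a <= x <= b)%R -> x != 0%R.
  by move=> xab; apply/eqP => x0; case: ab0 => h; lra.
pose sg : R := (if 0 < a then 1 else -1)%R.
have sgx x : (a <= x <= b)%R -> (`|x| = sg * x)%R.
  move=> xab; rewrite /sg; case: ifPn => [a0|]; first by rewrite mul1r ger0_norm //; lra.
  rewrite -leNgt => a0; rewrite mulN1r ler0_norm //; case: ab0; lra.
have sg2 : (sg * sg = 1)%R by rewrite /sg; case: ifP => _; ring.
have sgV : (sg^-1 = sg)%R by rewrite /sg; case: ifP => _; rewrite ?invrN invr1.
have sg1 : (`|sg| = 1)%R by rewrite /sg; case: ifP => _; rewrite ?normrN normr1.
pose F (x : R) : R := (sg / d * atan (expR (d / 2 * ln (x ^+ 2))))%R.
have dF x : (a <= x <= b)%R -> is_derive x (1%R : R) F (tail_density d x).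
  move=> xab; have x0 := nz x xab.
  have x2 : (0 < x ^+ 2)%R by rewrite exprn_even_gt0.
  have dX : is_derive x (1%R : R) (fun x : R => x ^+ 2)%R (2 * x)%R.
    by apply: is_derive_eq; rewrite /GRing.scale /=; ring.
  have d1 : is_derive x (1%R : R) (fun x : R => ln (x ^+ 2)) (2 / x)%R.
    have := @is_derive1_comp _ (@ln R) (fun x : R => x ^+ 2)%R x _ _ (is_derive1_ln x2) dX.
    by move=> h; apply: is_derive_eq; field.
  have d2 : is_derive x (1%R : R) (fun x : R => d / 2 * ln (x ^+ 2))%R (d / x)%R.
    by apply: is_derive_eq; rewrite /GRing.scale /=; field.
  have d3 := @is_derive1_comp _ atan _ x _ _ (is_derive1_atan _)
    (@is_derive1_comp _ expR _ x _ _ (is_derive_expR _) d2).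
  have d4 : is_derive x (1%R : R) (fun x => atan (expR (d / 2 * ln (x ^+ 2))))
    (d * x^-1 * (expR (d / 2 * ln (x ^+ 2)) / (1 + expR (d * ln (x ^+ 2)))))%R.
    apply: is_derive_eq; rewrite -expRM_natl.
    have -> : (2%:R * (d / 2 * ln (x ^+ 2)) = d * ln (x ^+ 2))%R by field.
    by field; rewrite x0 gt_eqF // addr_gt0 // expR_gt0.
  apply: is_derive_eq; rewrite /tail_density (sgx x xab) invfM.
  rewrite sgV.
  rewrite /GRing.scale /=; field.
  by rewrite x0 !gt_eqF // addr_gt0 // expR_gt0.
have cF x : (a <= x <= b)%R -> {for x, continuous F}.
  by move=> /dF h; apply/differentiable_continuous/derivable1_diffP; exact: ex_derive.
rewrite (@continuous_FTC2 _ _ F) //.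
- rewrite -EFinB lee_fin /F -mulrBr.
  set A := atan _; set B := atan _.
  have AB (z : R) : (0 <= z)%R -> (0 <= atan z <= pi / 2)%R.
    by move=> z0; rewrite (ltW (atan_ltpi2 z)) andbT -(@atan0 R) (le_atan z0).
  have A1 : (0 <= A <= pi / 2)%R by exact: AB (expR_ge0 _).
  have B1 : (0 <= B <= pi / 2)%R by exact: AB (expR_ge0 _).
  apply: le_trans (ler_norm _) _.
  rewrite normrM normrM sg1 mul1r normfV (gtr0_norm d0) mulrC ler_pM2r ?invr_gt0 //.
  by rewrite ler_norml; lra.
- apply: continuous_in_subspaceT => x /set_mem; rewrite /= in_itv /= => xab.
  exact: continuous_tail_density (nz x xab).
- split.
  + by move=> x; rewrite in_itv /= => /andP[ax xb]; have h := dF x ltac:(lra); exact: ex_derive.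
  + by apply: cvg_at_right_filter; apply: cF; rewrite lexx ltW.
  + by apply: cvg_at_left_filter; apply: cF; rewrite lexx ltW.
- move=> x; rewrite in_itv /= => /andP[ax xb]; have h := dF x ltac:(lra).
  by rewrite derive1E derive_val.
Qed.

(* The value [+oo] at [0] makes bounds by products of [etail_density] trivial on the
   coordinate hyperplanes. *)
Definition etail_density {R : realType} (d x : R) : \bar R :=
  if x == 0%R then +oo else (tail_density d x)%:E.

Lemma etail_density_gt0 {R : realType} (d x : R) : 0 < etail_density d x.
Proof.
rewrite /etail_density; case: eqVneq => [_|x0]; first exact: ltry.
by rewrite lte_fin mulr_gt0 ?invr_gt0 ?normr_gt0 // divr_gt0 ?addr_gt0 ?expR_gt0.
Qed.

Lemma measurable_etail_density {R : realType} (d : R) (D : set R) :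
  measurable D -> measurable_fun D (etail_density d).
Proof.
move=> mD; apply: (@measurable_funS _ _ _ _ [set: R]) => //.
rewrite /etail_density.
apply: measurable_fun_if => //.
- apply: (measurable_fun_bool true).
  rewrite setTI (_ : _ @^-1` _ = [set 0%R : R]); first exact: measurable_set1.
  by apply/seteqP; split => x /=; [move/eqP|move=> ->; exact: eqxx].
- rewrite setTI; apply/measurable_EFinP.
  rewrite (_ : _ @^-1` _ = ~` [set 0%R : R]); last first.
    by apply/seteqP; split => x /=; [move/eqP|move/eqP/negbTE].
  apply: open_continuous_measurable_fun.
    rewrite (_ : ~` _ = [set x : R | x != 0%R]); first exact: open_neq.
    by apply/seteqP; split => x /= /eqP.
  by move=> x /set_mem /= x0; apply: continuous_tail_density; apply/eqP.
Qed.

Lemma etail_density_integrable {R : realType} (d : R) : (0 < d)%R ->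
  \int[lebesgue_measure]_(x in [set: R]) etail_density d x < +oo.
Proof.
move=> d0.
(* The shift by 2 gives [1 / (i + 2) < i + 2], so the intervals are nondegenerate. The unions
   exhaust the complement of the null set where the density is [+oo]. *)
pose A (i : nat) : set R := `[(- i.+2%:R)%R, (- i.+2%:R^-1)%R]%classic.
pose B (i : nat) : set R := `[(i.+2%:R^-1)%R, i.+2%:R%R]%classic.
pose F i := A i `|` B i.
have mA i : measurable (A i) by exact: measurable_itv.
have mB i : measurable (B i) by exact: measurable_itv.
have mF i : measurable (F i) by exact: measurableU.
have i1 (i : nat) : (i.+2%:R^-1 < i.+2%:R :> R)%R.
  apply: (@lt_trans _ _ 1%R); last by rewrite (ltr_nat R 1).
  by rewrite invf_lt1 ?ltr0n // (ltr_nat R 1).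
have i0 (i : nat) : (0 < i.+2%:R^-1 :> R)%R by rewrite invr_gt0 ltr0n.
have eqE (D : set R) : (forall x, D x -> (x < 0 \/ 0 < x)%R) ->
    \int[lebesgue_measure]_(x in D) etail_density d x =
    \int[lebesgue_measure]_(x in D) (tail_density d x)%:E.
  move=> D0; apply: eq_integral => x /set_mem /D0 x0.
  by rewrite /etail_density; case: eqVneq => // x0'; case: x0; rewrite x0' ltxx.
have bound i : \int[lebesgue_measure]_(x in F i) etail_density d x <= (2 * (pi / d))%:E.
  rewrite ge0_integral_setU //.
  - rewrite mulr_natl mulr2n EFinD; apply: leeD.
    + rewrite eqE => [|x]; last first.
        rewrite /A /= in_itv /= => /andP[_ x0]; left.
        by apply: le_lt_trans x0 _; rewrite oppr_lt0.
      by apply: tail_density_integral_itv => //; [rewrite ltrN2|right; rewrite oppr_lt0].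
    + rewrite eqE => [|x]; last first.
        by rewrite /B /= in_itv /= => /andP[x0 _]; right; exact: lt_le_trans x0.
      by apply: tail_density_integral_itv => //; left.
  - exact: mA.
  - exact: mB.
  - by apply: measurable_etail_density; exact: mF.
  - by move=> x _; exact: ltW (etail_density_gt0 _ _).
  - apply/disj_setPS => x []; rewrite /A /B /= !in_itv /= => /andP[_ h1] /andP[h2 _].
    have := lt_le_trans (i0 i) h2; rewrite ltNge => /negP; apply.
    by apply: le_trans h1 _; rewrite oppr_le0 ltW.
have ndF : {homo F : n m / (n <= m)%N >-> (n <= m)%O}.
  move=> n m nm; apply/subsetPset => x; rewrite /F /A /B /= !in_itv /=.
  have nm1 : (n.+2%:R <= m.+2%:R :> R)%R by rewrite ler_nat.
  have nm2 : (m.+2%:R^-1 <= n.+2%:R^-1 :> R)%R by rewrite lef_pV2 // posrE ltr0n.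
  move=> [|] /andP[h1 h2]; [left|right]; apply/andP; split.
  - by apply: le_trans h1; rewrite lerN2.
  - by apply: le_trans h2 _; rewrite lerN2.
  - exact: le_trans h1.
  - exact: le_trans h2 _.
have UF : \bigcup_i F i = ~` [set 0%R].
  apply/seteqP; split => x.
    move=> [i _]; rewrite /F /A /B /= !in_itv /= => h x0; subst x.
    case: h => /andP[h1 h2].
      by move: h2; rewrite leNgt oppr_lt0 i0.
    by move: h1; rewrite leNgt i0.
  move=> /= /eqP x0.
  have nx : (0 < `|x|)%R by rewrite normr_gt0.
  pose i := Num.truncn (Num.max `|x| `|x|^-1)%R; exists i => //.
  have hi : (Num.max `|x| `|x|^-1 < i.+2%:R)%R.
    by apply: lt_trans (truncnS_gt _) _; rewrite ltr_nat.
  move: hi; rewrite gt_max => /andP[h1 h2].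
  have h3 : (i.+2%:R^-1 <= `|x|)%R.
    by rewrite invf_ple ?posrE ?ltr0n // ltW.
  rewrite /F /A /B /= !in_itv /=.
  have [xp|xn] := leP 0%R x.
    by right; rewrite ger0_norm // in h1 h3; rewrite h3 ltW.
  by left; rewrite ltr0_norm // in h1 h3; rewrite lerNl lerNr h3 ltW.
have lim : \int[lebesgue_measure]_(x in ~` [set 0%R : R]) etail_density d x <= (2 * (pi / d))%:E.
  have cv : \int[lebesgue_measure]_(x in F i) etail_density d x @[i --> \oo] -->
      \int[lebesgue_measure]_(x in ~` [set 0%R : R]) etail_density d x.
    rewrite -UF; apply: ge0_nondecreasing_set_cvg_integral => //.
    - by move=> i; apply: measurable_etail_density; exact: mF.
    - by move=> i x _; exact: ltW (etail_density_gt0 _ _).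
  rewrite -(cvg_lim _ cv) //; apply: lime_le; first by apply/cvg_ex; eexists; exact: cv.
  by near=> i; exact: bound.
apply: le_lt_trans (ltry (2 * (pi / d))%R).
rewrite -(setvU [set 0%R]) ge0_integral_setU //.
- by rewrite integral_set1 adde0.
- by apply: measurableC.
- by apply: measurable_etail_density; rewrite setvU; exact: measurableT.
- by move=> x _; exact: ltW (etail_density_gt0 _ _).
- by apply/disj_setPS => x [].
Unshelve. all: by end_near.
Qed.

(** As [d <= 1], [- s - d |s|] is nonincreasing, so the logarithm of any larger modulus may be
    inserted: [rho = |z_k|] serves both real coordinates of [z_k], which separates the variables. *)
Lemma tail_density_lower {R : realType} (d x rho : R) :
  (0 < d <= 1)%R -> x != 0%R -> (`|x| <= rho)%R ->
  (expR (- ln rho - d * `|ln rho|) <= 2 * tail_density d x)%R.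
Proof.
move=> d01 x0 xr.
have ax : (0 < `|x|)%R by rewrite normr_gt0.
have r0 : (0 < rho)%R by exact: lt_le_trans xr.
set t := ln `|x|%R.
have tr : (t <= ln rho)%R by rewrite ler_ln ?posrE.
have lx : (ln (x ^+ 2) = 2 * t)%R.
  by rewrite -real_normK ?num_real // lnXn // mulr_natl.
have ex : (`|x|^-1 = expR (- t))%R by rewrite expRN lnK ?posrE.
apply: (@le_trans _ _ (expR (- t - d * `|t|))).
  rewrite ler_expR.
  move: tr; set s := ln rho => ts.
  have h : (`|t| - `|s| <= s - t)%R.
    apply: le_trans (ler_norm _) _; apply: le_trans (ler_dist_dist _ _) _.
    by rewrite distrC ger0_norm // subr_ge0.
  have : (d * (`|t| - `|s|) <= s - t)%R.
    apply: (@le_trans _ _ (d * (s - t))%R); first by rewrite ler_wpM2l //; lra.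
    have : (0 <= s - t)%R by rewrite subr_ge0.
    by nra.
  lra.
rewrite /tail_density lx ex expRD mulrCA.
rewrite ler_pM2l ?expR_gt0 //.
rewrite [leRHS]mulrA ler_pdivlMr; last by rewrite addr_gt0 ?expR_gt0.
have -> : (d / 2 * (2 * t) = d * t)%R by field.
have -> : (d * (2 * t) = d * t + d * t)%R by ring.
rewrite expRD mulrDr mulr1 mulrA -expRD.
have h1 : (- (d * `|t|) <= d * t)%R.
  by rewrite -mulrN ler_wpM2l //; [lra|rewrite lerNl; have := ler_norm (- t)%R; rewrite normrN].
have h2 : (expR (- (d * `|t|) + d * t) <= 1)%R.
  by rewrite -[leRHS]expR0 ler_expR; have := ler_norm t; nra.
have e0 := expR_gt0 (d * t)%R.
have : (expR (- (d * `|t|)) <= expR (d * t))%R by rewrite ler_expR.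
nra.
Qed.

Lemma prodEFin {R : realType} (I : finType) (F : I -> R) :
  \big[*%E/1]_i (F i)%:E = (\prod_i F i)%:E.
Proof. by rewrite (big_morph EFin (@EFinM R) erefl). Qed.

(** * Criteria for convergence and divergence of the integral *)

Lemma int_outside_lty {R : realType} {n : nat} (v : Cn R n -> \bar R) (K : set (Cn R n))
    (c d C : R) :
  (0 < c)%R -> (0 < d <= 1)%R ->
  (forall z, ~ K z -> (forall k, cabs z k != 0%R) ->
    (\sum_k ln (cabs z k) + d * \sum_k `|ln (cabs z k)| - C)%:E <= c%:E * v z) ->
  int_outside K (fun z => expeR (- (2 * c)%:E * v z)) < +oo.
Proof.
move=> c0 d01 vlow.
(* [e^(2 C)] comes from the additive constant, and each of the [2 n] real coordinates costs a factor
   2. *)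
pose a : R := (expR (2 * C) * 4 ^+ n)%R.
have a0 : (0 < a)%R by rewrite mulr_gt0 ?expR_gt0 ?exprn_gt0.
apply: (@le_lt_trans _ _ (iter_int (2 * n) (fun s => \sum_(i <- [:: tt])
   a%:E * \big[*%E/1]_(j < 2 * n) etail_density d (s j)))); last first.
  rewrite (@iter_int_sum_prod _ _ _ _ (fun=> a%:E) (fun _ _ => etail_density d)).
  - rewrite big_seq1; apply: lte_mul_pinfty => //; first by rewrite lee_fin ltW.
    set I := \int[lebesgue_measure]_x _.
    suff : 0 <= \big[*%E/1]_(j < 2 * n) I < +oo by case/andP.
    elim/big_ind : _ => [|x y /andP[x0 xy] /andP[y0 yy]|_ _].
    + by rewrite lee01 ltry.
    + by rewrite mule_ge0 //= lte_mul_pinfty // ge0_fin_numE.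
    + rewrite etail_density_integrable ?integral_ge0 //; last by case/andP: d01.
      by move=> x _; exact: ltW (etail_density_gt0 _ _).
  - by move=> _; rewrite lee_fin ltW.
  - by move=> _ _ x; exact: ltW (etail_density_gt0 _ _).
  - by move=> _ _; apply: measurable_etail_density.
apply: le_iter_int => s; rewrite big_seq1; cbv beta.
have pos : 0 < \big[*%E/1]_(j < 2 * n) etail_density d (s j).
  elim/big_ind : _ => [|x y|j _]; [exact: lte01|exact: mule_gt0|exact: etail_density_gt0].
case: pselect => [Kz|nK] /=; first by rewrite mule_ge0 ?lee_fin ?(ltW a0) ?(ltW pos).
have [/existsP[j /eqP sj]|] := boolP [exists j : 'I_(2 * n), s j == 0%R].
  rewrite (bigD1 j) //= sj {1}/etail_density eqxx.
  rewrite gt0_mulye ?gt0_muley ?leey ?lte_fin //.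
  elim/big_ind : _ => [|x y|i _]; [exact: lte01|exact: mule_gt0|exact: etail_density_gt0].
rewrite negb_exists => /forallP s0.
set z := (_, _) in nK *.
have jx (k : 'I_n) : (k < 2 * n)%N by rewrite mul2n -addnn ltn_addr.
have jy (k : 'I_n) : (n + k < 2 * n)%N by rewrite mul2n -addnn ltn_add2l.
have sx (k : 'I_n) : s k != 0%R by exact: s0 (Ordinal (jx k)).
have sy (k : 'I_n) : s (n + k)%N != 0%R by exact: s0 (Ordinal (jy k)).
have xr (k : 'I_n) : (`|s k| <= cabs z k)%R.
  by rewrite /cabs /= !mxE -sqrtr_sqr ler_sqrt ?addr_ge0 ?sqr_ge0 // lerDl sqr_ge0.
have yr (k : 'I_n) : (`|s (n + k)%N| <= cabs z k)%R.
  by rewrite /cabs /= !mxE -sqrtr_sqr ler_sqrt ?addr_ge0 ?sqr_ge0 // lerDr sqr_ge0.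
have cz k : cabs z k != 0%R.
  by rewrite gt_eqF //; apply: lt_le_trans (xr k); rewrite normr_gt0.
have := vlow z nK cz; set L := (_ + _ - C)%R => hL.
apply: (@le_trans _ _ (expeR (- (2 * L))%:E)).
  rewrite lee_expeR; move: hL; case: (v z) => [y| |].
  - by rewrite -!EFinM !lee_fin; lra.
  - by move=> _; rewrite mulry ltr0_sg ?oppr_lt0 ?mulr_gt0 // mulN1e leNye.
  - by rewrite mulrNy gtr0_sg // mul1e leeNy_eq.
rewrite (big_ord_double n (fun j => etail_density d (s j))) -big_split /=.
under eq_bigr => k _ do rewrite /etail_density (negbTE (sx k)) (negbTE (sy k)) -EFinM.
rewrite prodEFin /expeR -EFinM lee_fin.
have -> : (expR (- (2 * L)) = expR (2 * C) *
    \prod_(k < n) expR (- ln (cabs z k) - d * `|ln (cabs z k)|) ^+ 2)%R.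
  under eq_bigr do rewrite -expRM_natl.
  rewrite -expR_sum -expRD /L; congr expR.
  by rewrite -[X in _ = (_ + X)%R]mulr_sumr sumrB sumrN -mulr_sumr; ring.
rewrite /a -mulrA ler_pM2l ?expR_gt0 //.
have -> : (4 ^+ n = \prod_(k < n) 4 :> R)%R by rewrite prodr_const card_ord.
rewrite -big_split /=; apply: ler_prod => k _; rewrite sqr_ge0 /=.
have h1 := tail_density_lower d _ _ d01 (sx k) (xr k).
have h2 := tail_density_lower d _ _ d01 (sy k) (yr k).
have := expR_ge0 (- ln (cabs z k) - d * `|ln (cabs z k)|)%R.
move: h1 h2; set e := expR _; rewrite expr2 => h1 h2 e0.
have := ler_pM e0 e0 h1 h2; lra.
Qed.

Lemma compact_coord_bounded {R : realType} {n : nat} (K : set (Cn R n)) (k : 'I_n) :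
  compact K -> exists rho : R, forall z, K z -> (`|z.1 ord0 k| <= rho)%R.
Proof.
move=> cK.
have ck : continuous (fun z : Cn R n => z.1 ord0 k).
  move=> x; apply: (@continuous_comp _ _ _ fst (fun y : 'rV[R]_n => y ord0 k)).
    exact: cvg_fst.
  exact: coord_continuous.
have := @compact_bounded R _ _ (continuous_compact (continuous_subspaceT ck) cK).
case=> M [_ hM]; exists (M + 1)%R => z Kz.
by apply: (hM (M + 1)%R); [rewrite ltrDl|exists z].
Qed.

(* The boxes [E/2 < x_k, y_k <= E], [E = e^(N t_k)], contribute a fixed positive amount
   for each [N]; taking [N] in steps of [q] with [q t_k >= 1] makes them disjoint. *)
Lemma int_outside_pinfty {R : realType} {n : nat} (v : Cn R n -> \bar R) (K : set (Cn R n))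
    (t : 'rV[R]_n) (c al B : R) :
  (0 < c)%R -> (0 < \sum_k t ord0 k)%R -> (c * al <= \sum_k t ord0 k)%R -> compact K ->
  (forall (N : nat) (z : Cn R n),
     (forall k, expR (N%:R * t ord0 k - 1) <= cabs z k <= expR (N%:R * t ord0 k + 1))%R ->
     v z <= (B + N%:R * al)%:E) ->
  ~ (int_outside K (fun z => expeR (- (2 * c)%:E * v z)) < +oo).
Proof.
move=> c0 st0 cal cK vub intfin.
have [k tk] := sum_gt0_coord t st0.
have [rho Krho] := compact_coord_bounded K k cK.
pose q := (Num.truncn (t ord0 k)^-1).+1.
have qt : (1 <= q%:R * t ord0 k)%R.
  by rewrite -ler_pdivrMr // mul1r ltW // truncnS_gt.
(* From this index on the k-th edge exceeds [2 rho], so the boxes lie outside [K]. *)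
pose i0 := (Num.truncn (2 * rho)).+1.
have i0r : (2 * rho < i0%:R)%R by exact: truncnS_gt.
pose N i := (q * (i0 + i))%N.
(* Real coordinates [l] and [n + l] both belong to [z_l]; the default of [insubd] is never taken,
   since [j %% n < n]. *)
pose tn j := t ord0 (insubd k (j %% n)%N).
pose E i j : R := expR ((N i)%:R * tn j).
pose h i j (x : R) : \bar R := (\1_(`](E i j / 2)%R, E i j]%classic : set R) x)%:E.
pose a i : \bar R := (expR (- (2 * c) * (B + (N i)%:R * al)))%:E.
have E0 i j : (0 < E i j)%R by exact: expR_gt0.
have tnx (l : 'I_n) : tn l = t ord0 l by rewrite /tn modn_small // valKd.
have tny (l : 'I_n) : tn (n + l)%N = t ord0 l by rewrite /tn modnDl modn_small // valKd.
have inth i j : \int[lebesgue_measure]_x h i j x = (E i j / 2)%:E.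
  rewrite integral_indic // setIT.
  have := lebesgue_measure_itv `](E i j / 2)%R, E i j]; rewrite /= lte_fin => ->.
  rewrite ltr_pdivrMr // ltr_pMr // ltr1n -EFinB; congr EFin.
  by have := E0 i j; lra.
(* A box has volume [4^-n e^(2 N sum t)] and the integrand there is at least [e^(-2 c (B + N al))];
   as [c al <= sum t], the dependence on [N] can only help. *)
pose kappa : R := (expR (- (2 * c) * B) * 4^-1 ^+ n)%R.
have kappa0 : (0 < kappa)%R by rewrite mulr_gt0 ?expR_gt0 // exprn_gt0.
have lower M : (M%:R * kappa)%:E <= int_outside K (fun z => expeR (- (2 * c)%:E * v z)).
  apply: (@le_trans _ _ (iter_int (2 * n) (fun s => \sum_(i <- index_enum 'I_M)
     a i * \big[*%E/1]_(j < 2 * n) h i j (s j)))).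
    rewrite (@iter_int_sum_prod _ _ 'I_M _ (fun i => a i) (fun i => h i)) //.
    - apply: (@le_trans _ _ (\sum_(i < M) kappa%:E)).
        by rewrite sumEFin sumr_const card_ord mulr_natl.
      apply: lee_sum => i _.
      under eq_bigr do rewrite inth.
      rewrite prodEFin -EFinM lee_fin.
      have -> : (\prod_(j < 2 * n) (E i j / 2) =
          4^-1 ^+ n * expR (2 * ((N i)%:R * \sum_l t ord0 l)))%R.
        apply: EFin_inj; rewrite -prodEFin (big_ord_double n (fun j => (E i j / 2)%:E)).
        rewrite !prodEFin -EFinM.
        congr EFin; rewrite -big_split /=.
        transitivity (\prod_(l < n) (4^-1 * expR (2 * ((N i)%:R * t ord0 l))))%R.
          apply: eq_bigr => l _; rewrite /E tnx tny; set x := ((N i)%:R * t ord0 l)%R.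
          by have -> : (2 * x = x + x)%R; [ring|rewrite expRD; field].
        by rewrite big_split /= prodr_const card_ord -expR_sum -!mulr_sumr.
      rewrite /kappa [leRHS]mulrCA [leLHS]mulrC ler_pM2l ?exprn_gt0 //.
      rewrite -expRD ler_expR.
      have := ler_wpM2l (ler0n R (N i)) cal; lra.
    - by move=> i; rewrite lee_fin expR_ge0.
    - by move=> i j x; rewrite lee_fin.
    - move=> i j; apply/measurable_EFinP; exact: measurable_indic.
  apply: le_iter_int => s; cbv beta.
  set z := (_, _).
  pose inbox (i : 'I_M) := [forall j : 'I_(2 * n), s j \in `](E i j / 2)%R, E i j]].
  have prod1 i : inbox i -> \big[*%E/1]_(j < 2 * n) h i j (s j) = 1.
    move=> /forallP sin; apply: big1 => j _.
    by rewrite /h indicE mem_set //; exact: (sin j).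
  have prod0 i : ~~ inbox i -> \big[*%E/1]_(j < 2 * n) h i j (s j) = 0.
    rewrite negb_forall => /existsP [j sj].
    rewrite (bigD1 j) //= /h indicE memNset ?mul0e //=.
    by move=> sj'; move/negP: sj.
  have rhs0 : 0 <= (if is_left (pselect (K z)) then 0 else expeR (- (2 * c)%:E * v z)).
    by case: pselect => [Kz|nK] //=; exact: expeR_ge0.
  have [/existsP [i bi]|] := boolP [exists i, inbox i]; last first.
    rewrite negb_exists => /forallP nb; rewrite big1 // => i _.
    by rewrite prod0 ?mule0.
  have jx (l : 'I_n) : (l < 2 * n)%N by rewrite mul2n -addnn ltn_addr.
  have jy (l : 'I_n) : (n + l < 2 * n)%N by rewrite mul2n -addnn ltn_add2l.
  have Emono (i1 i2 : 'I_M) : (i1 < i2)%N -> (E i1 k <= E i2 k / 2)%R.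
    move=> i12; rewrite ler_pdivlMr // /E tnx.
    have e2 : (2 <= expR (1 : R))%R by have := expR_ge1Dx (1 : R); lra.
    apply: (@le_trans _ _ (expR ((N i1)%:R * t ord0 k) * expR 1))%R.
      by rewrite ler_pM2l ?expR_gt0.
    rewrite -expRD ler_expR /N !natrM !natrD.
    have : (i1%:R + 1 <= i2%:R :> R)%R by rewrite natr1 ler_nat.
    have := ler0n R q; nra.
  have uniq_box i' : i' != i -> ~~ inbox i'.
    move=> ii'; apply/negP => /forallP /(_ (Ordinal (jx k))) b'.
    have := forallP bi (Ordinal (jx k)); move: b'; rewrite !in_itv /= => /andP[h1 h2] /andP[h3 h4].
    have [lt|lt|/val_inj e] := ltngtP i' i; last by rewrite e eqxx in ii'.
    - by have := Emono _ _ lt; lra.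
    - by have := Emono _ _ lt; lra.
  have -> : \sum_(i' < M) a i' * \big[*%E/1]_(j < 2 * n) h i' j (s j) = a i.
    rewrite (bigD1 i) // prod1 // mule1 big1 => [|i' ii']; first exact: adde0.
    by rewrite prod0 ?mule0 // uniq_box.
  have sx (l : 'I_n) : (E i l / 2 < s l <= E i l)%R.
    by have := forallP bi (Ordinal (jx l)); rewrite in_itv.
  have sy (l : 'I_n) : (E i (n + l)%N / 2 < s (n + l)%N <= E i (n + l)%N)%R.
    by have := forallP bi (Ordinal (jy l)); rewrite in_itv.
  case: pselect => [Kz|nK] /=.
    have := Krho _ Kz; rewrite /= mxE leNgt => /negP; case.
    apply: lt_le_trans (ler_norm _); have /andP[+ _] := sx k; apply: le_lt_trans.
    rewrite ler_pdivlMr // mulrC /E tnx ltW //; apply: lt_le_trans i0r _.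
    apply: le_trans (expR_ge1Dx _); rewrite /N natrM natrD.
    have := ler0n R i; have := ler0n R i0; nra.
  have zub l : (expR ((N i)%:R * t ord0 l - 1) <= cabs z l <= expR ((N i)%:R * t ord0 l + 1))%R.
    have := sx l; have := sy l; rewrite /E tnx tny expRD expRN expRD.
    rewrite /cabs /= !mxE.
    set e := expR (_ * _); set x := s l; set y := s (n + l)%N => hy hx.
    have e0 : (0 < e)%R by exact: expR_gt0.
    have e2 : (2 <= expR (1 : R))%R by have := expR_ge1Dx (1 : R); lra.
    have ei : ((expR 1)^-1 <= 2^-1 :> R)%R by rewrite lef_pV2 // posrE ?expR_gt0.
    apply/andP; split.
      apply: (@le_trans _ _ (e / 2)%R); first by rewrite ler_pM2l.
      rewrite -[leLHS]ger0_norm; last lra.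
      rewrite -sqrtr_sqr ler_sqrt ?addr_ge0 ?sqr_ge0 //; nra.
    apply: (@le_trans _ _ (e * 2)%R); last by rewrite ler_pM2l.
    rewrite -[leRHS]ger0_norm; last lra.
    by rewrite -sqrtr_sqr ler_sqrt ?sqr_ge0 //; nra.
  have := vub _ _ zub; rewrite /a.
  have -> : (expR (- (2 * c) * (B + (N i)%:R * al)))%:E =
      expeR (- (2 * c) * (B + (N i)%:R * al))%:E by [].
  rewrite lee_expeR; case: (v z) => [y| |].
  - by rewrite -EFinM !lee_fin => hy; rewrite !mulNr lerN2 ler_pM2l // mulr_gt0.
  - by rewrite leye_eq.
  - by rewrite mulrNy ltr0_sg ?oppr_lt0 ?mulr_gt0 // mulN1e /= leey.
have fin : int_outside K (fun z => expeR (- (2 * c)%:E * v z)) \is a fin_num.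
  by rewrite ge0_fin_numE //; have := lower 0%N; rewrite mul0r.
move: lower; rewrite -(fineK fin); set I := fine _ => lower.
have := lower (Num.truncn (I / kappa)).+1; rewrite lee_fin leNgt => /negP; apply.
by rewrite -ltr_pdivrMr // truncnS_gt.
Qed.

(** * Equivalence of the conditions on [c] *)

Lemma log_profile_exhaustion {R : realType} {n : nat} (u : Cn R n -> \bar R) :
  (0 < n)%N -> LPSHstar u -> toric u -> convex_exhaustion (log_profile u).
Proof.
move=> n0 su tu; split.
- by move=> p v s; exact: log_profile_convex.
- by move=> t t'; exact: log_profile_homo.
- by move=> M; exact: log_profile_lower.
- exact: log_profile_upper.
Qed.

(** Meaningful only off the coordinate hyperplanes; the default value of [ln] at 0 never enters an
    estimate. *)
Definition logmod {R : realType} {n : nat} (z : Cn R n) : 'rV[R]_n := \row_k ln (cabs z k).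

Lemma cabs_expR_logmod {R : realType} {n : nat} (z : Cn R n) k :
  cabs z k != 0%R -> cabs z k = expR (logmod z ord0 k).
Proof. by move=> z0; rewrite mxE lnK // posrE lt_neqAle eq_sym z0 sqrtr_ge0. Qed.

Lemma Psi_recession {R : realType} {n : nat} (u : Cn R n -> \bar R) (z : Cn R n) :
  (0 < n)%N -> LPSHstar u -> toric u -> (forall k, cabs z k != 0%R) ->
  Psi u z = (recession (log_profile u) (logmod z))%:E.
Proof.
move=> n0 su tu z0; rewrite /Psi; case: pselect => // _ /=.
have ce := log_profile_exhaustion u n0 su tu.
rewrite /Psi0.
have -> : (fun r : R => (r^-1)%:E * ereal_sup [set u w | w in
    [set w : Cn R n | forall k, (cabs w k <= cabs z k `^ r)%R]]) =
  (fun r => (r^-1 * log_profile u (r *: logmod z))%:E).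
  apply/funext => r; rewrite EFinM; congr (_ * _).
  have zr k : (cabs z k `^ r = expR ((r *: logmod z) ord0 k))%R.
    by rewrite /powR (negbTE (z0 k)) !mxE.
  apply/eqP; rewrite eq_le; apply/andP; split.
    apply: ge_ereal_sup => _ [w wz <-]; apply: polydisk_sup => // k.
    by rewrite -zr; exact: wz.
  apply: ereal_sup_ubound; exists (logpt (r *: logmod z)); last by rewrite log_profileE.
  by move=> k /=; rewrite cabs_logpt zr.
apply: cvg_lim => //; apply: cvg_EFin; first by near=> r.
exact: recession_cvg.
Unshelve. all: by end_near.
Qed.

Lemma psi_recession {R : realType} {n : nat} (u : Cn R n -> \bar R) (t : 'rV[R]_n) :
  (0 < n)%N -> LPSHstar u -> toric u ->
  psi u t = (recession (log_profile u) t)%:E.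
Proof.
move=> n0 su tu; rewrite /psi Psi_recession //.
  congr (recession _ _)%:E; apply/rowP => k.
  by rewrite mxE (cabs_logpt t k) expRK.
by move=> k; rewrite (cabs_logpt t k) gt_eqF // expR_gt0.
Qed.

Lemma dotR_one {R : realType} {n : nat} (a : R) (t : 'rV[R]_n) :
  (dotR (a *: one_vec R n) t = a * \sum_k t ord0 k)%R.
Proof. by rewrite mulr_sumr; apply: eq_bigr => k _; rewrite !mxE mulr1. Qed.

Lemma dotR_onel {R : realType} {n : nat} (t : 'rV[R]_n) :
  (dotR t (one_vec R n) = \sum_k t ord0 k)%R.
Proof. by apply: eq_bigr => k _; rewrite mxE mulr1. Qed.

Lemma abse_expeR_sqr {R : realType} (c : R) (y : \bar R) : (0 < c)%R ->
  `|expeR (- c%:E * y)| * `|expeR (- c%:E * y)| = expeR (- (2 * c)%:E * y).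
Proof.
move=> c0; rewrite gee0_abs ?expeR_ge0 // -expeRD; congr expeR.
case: y => [y| |].
- by rewrite -!EFinN -!EFinM -EFinD; congr EFin; ring.
- by rewrite mulry ltr0_sg ?oppr_lt0 // mulN1e mulry ltr0_sg ?oppr_lt0 ?mulr_gt0 // mulN1e.
- by rewrite mulrNy ltr0_sg ?oppr_lt0 // mulN1e mulrNy ltr0_sg ?oppr_lt0 ?mulr_gt0 // mulN1e.
Qed.

Section main_equivalences.
Context {R : realType} {n : nat} (u : Cn R n -> \bar R).
Hypotheses (n0 : (0 < n)%N) (su : LPSHstar u) (tu : toric u).

Let phi := log_profile u.
Let ce : convex_exhaustion phi := log_profile_exhaustion u n0 su tu.

(** [int_outside_lty] asks for bounds only where no coordinate vanishes, so the extension of [Psi u]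
    to the hyperplanes does not enter; by homogeneity [Psi u] needs no additive constant. *)
Lemma dominates_int_lty (K : set (Cn R n)) c : (0 < c)%R ->
  @unit_polydisk R n `<=` K -> dominates phi c ->
  int_outside K (fun z => expeR (- (2 * c)%:E * u z)) < +oo /\
  int_outside K (fun z => expeR (- (2 * c)%:E * Psi u z)) < +oo.
Proof.
move=> c0 DK dom; have [d d01 [C hC]] := dominates_growth phi c ce c0 dom.
have out z : ~ K z -> (forall k, cabs z k != 0%R) -> exists k, (0 <= logmod z ord0 k)%R.
  move=> nK z0; apply: contrapT => h; apply: nK; apply: DK => k.
  rewrite ltNge; apply/negP => zk; apply: h; exists k.
  by rewrite mxE ln_ge0.
have sumE z : (\sum_k ln (cabs z k) = \sum_k logmod z ord0 k)%R.
  by apply: eq_bigr => k _; rewrite mxE.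
have sumNE z : (\sum_k `|ln (cabs z k)| = \sum_k `|logmod z ord0 k|)%R.
  by apply: eq_bigr => k _; rewrite mxE.
split.
- apply: (int_outside_lty _ _ c d C) => // z nK z0; have [k zk] := out z nK z0.
  have -> : u z = (phi (logmod z))%:E.
    rewrite /phi -log_profileE //; apply: toric_eq => // j.
    by rewrite cabs_logpt -cabs_expR_logmod.
  by rewrite -EFinM lee_fin sumE sumNE; case: (hC (logmod z) k zk).
- apply: (int_outside_lty _ _ c d 0%R) => // z nK z0; have [k zk] := out z nK z0.
  rewrite Psi_recession // -EFinM lee_fin subr0 sumE sumNE.
  by case: (hC (logmod z) k zk).
Qed.

(** By contraposition: the box around [e^(N t)] lies in the polydisk of logarithmic radii
    [1 + N t_k], where either function is at most its value at logarithmic point [const_mx 1] plus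
    [N] times [recession phi t]. *)
Lemma int_lty_dominates (K : set (Cn R n)) (v : Cn R n -> \bar R) c : (0 < c)%R ->
  compact K -> v = u \/ v = Psi u ->
  int_outside K (fun z => expeR (- (2 * c)%:E * v z)) < +oo -> dominates phi c.
Proof.
move=> c0 cK vE fin t st0; rewrite ltNge; apply/negP => ct.
case: vE fin => ->.
- apply: (int_outside_pinfty _ _ t c (recession phi t) (phi (const_mx 1%R))) => // N z zN.
  apply: le_trans (polydisk_sup u (const_mx 1 + N%:R *: t)%R z n0 su tu _) _.
    by move=> k; have /andP[_] := zN k; rewrite !mxE addrC.
  by rewrite lee_fin; apply: recession_shift.
- apply: (int_outside_pinfty _ _ t c (recession phi t) (recession phi (const_mx 1%R))) => // N z zN.
  have z0 k : cabs z k != 0%R.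
    by rewrite gt_eqF //; have /andP[+ _] := zN k; apply: lt_le_trans; exact: expR_gt0.
  rewrite Psi_recession // lee_fin; apply: recession_le_shift => // k.
  have /andP[_ +] := zN k; rewrite cabs_expR_logmod // ler_expR.
  by rewrite addrC => h; apply: le_trans h _; rewrite !mxE.
Qed.

Lemma eratio_psi (t : 'rV[R]_n) : (0 < \sum_k t ord0 k)%R ->
  eratio (dotR t (one_vec R n)) (psi u t) = ((\sum_k t ord0 k) / recession phi t)%:E /\
  (0 < recession phi t)%R.
Proof.
move=> st0; have [k tk] := sum_gt0_coord t st0.
have r0 : (0 < recession phi t)%R by exact: recession_gt0 tk.
by rewrite psi_recession // dotR_onel /eratio leNgt r0.
Qed.

Lemma sup_ratio_le c : sup_ratio u <= c%:E <->
  forall t : 'rV[R]_n, (0 < \sum_k t ord0 k -> \sum_k t ord0 k <= c * recession phi t)%R.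
Proof.
split=> [h t st0|h].
  have [e r0] := eratio_psi t st0.
  have : eratio (dotR t (one_vec R n)) (psi u t) <= c%:E.
    apply: le_trans h; apply: ereal_sup_ubound; exists t => //=.
    by rewrite /Hplus /= dotR_onel.
  by rewrite e lee_fin ler_pdivrMr.
apply: ge_ereal_sup => _ [t /= Ht <-]; rewrite /Hplus /= dotR_onel in Ht.
by have [-> r0] := eratio_psi t Ht; rewrite lee_fin ler_pdivrMr // h.
Qed.

(** Strictness could be lost in the supremum; the margin [d] bounds every ratio by [c / (1 + d)]. *)
Lemma sup_ratio_lt c : (0 < c)%R -> sup_ratio u < c%:E <-> dominates phi c.
Proof.
move=> c0; split=> [h t st0|dom].
  have [e r0] := eratio_psi t st0.
  have : eratio (dotR t (one_vec R n)) (psi u t) < c%:E.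
    apply: le_lt_trans h; apply: ereal_sup_ubound; exists t => //=.
    by rewrite /Hplus /= dotR_onel.
  by rewrite e lte_fin ltr_pdivrMr.
have [d /andP[d0 d1] [C hC]] := dominates_growth phi c ce c0 dom.
apply: (@le_lt_trans _ _ (c / (1 + d))%:E); last first.
  by rewrite lte_fin ltr_pdivrMr ?addr_gt0 //; nra.
apply/sup_ratio_le => t st0; have [k tk] := sum_gt0_coord t st0.
have [_ h] := hC t k (ltW tk).
have : (\sum_k t ord0 k <= \sum_k `|t ord0 k|)%R by apply: ler_sum => i _; exact: ler_norm.
rewrite mulrAC ler_pdivlMr ?addr_gt0 //; nra.
Qed.

Lemma maxe_psi (t : 'rV[R]_n) (x : R) :
  x%:E <= maxe (psi u t) 0 <-> (x <= recession phi t \/ x <= 0)%R.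
Proof.
rewrite psi_recession // le_max !lee_fin.
by split => [/orP|[] ->]; rewrite ?orbT.
Qed.

Lemma Gamma_sup_ratio c : (0 < c)%R ->
  Gamma_inf u (c^-1 *: one_vec R n) <-> sup_ratio u <= c%:E.
Proof.
move=> c0; rewrite sup_ratio_le; split=> [h t st0|h t].
  have := h t; rewrite dotR_one => /maxe_psi [|].
    by rewrite mulrC ler_pdivrMr // mulrC.
  by rewrite leNgt mulr_gt0 // invr_gt0.
rewrite dotR_one; apply/maxe_psi.
have [st0|st0] := ltP 0%R (\sum_k t ord0 k)%R.
  by left; rewrite mulrC ler_pdivrMr // mulrC; exact: h.
by right; rewrite pmulr_rle0 // invr_gt0.
Qed.

(** A step [e / 2] outward along the diagonal yields strictness. Conversely the term [d sum |t_k|]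
    absorbs a displacement of [d / c] per coordinate, and for [t] with all coordinates negative the
    displaced point still has positive coordinates. *)
Lemma interior_Gamma_dominates c : (0 < c)%R ->
  interior (Gamma_inf u) (c^-1 *: one_vec R n) <-> dominates phi c.
Proof.
move=> c0; split.
  move=> /nbhs_ballP [e /= e0 he] t st0.
  have := he ((c^-1 + e / 2) *: one_vec R n) _ t.
  have cinv : (0 < c^-1)%R by rewrite invr_gt0.
  rewrite dotR_one => h.
  have /h /maxe_psi [] : ball (c^-1 *: one_vec R n) e ((c^-1 + e / 2) *: one_vec R n).
    split => // i j; rewrite /ball /= !mxE !mulr1 opprD addrA subrr sub0r normrN.
    by rewrite gtr0_norm ?divr_gt0 // ltr_pdivrMr // ltr_pMr // ltr1n.
  - move=> h1; have := ler_wpM2l (ltW c0) h1.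
    rewrite mulrA mulrDr divff ?gt_eqF // mulrDl mul1r; apply: lt_le_trans.
    by rewrite ltrDl !mulr_gt0 ?divr_gt0.
  - by rewrite leNgt mulr_gt0 // addr_gt0 // divr_gt0.
move=> dom; have [d /andP[d0 d1] [C hC]] := dominates_growth phi c ce c0 dom.
apply/nbhs_ballP; exists (d / c)%R; first by rewrite /= divr_gt0.
move=> a [_ ha] t.
have {}ha k : (`|c^-1 - a ord0 k| < d / c)%R.
  by have := ha ord0 k; rewrite /ball /= !mxE mulr1.
apply/maxe_psi.
have [/existsP[k tk]|] := boolP [exists k, 0%R <= t ord0 k]%R.
  left; have [_ h] := hC t k tk.
  rewrite -(ler_pM2l c0); apply: le_trans h.
  rewrite /dotR !mulr_sumr -big_split /=; apply: ler_sum => i _.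
  have -> : (c * (a ord0 i * t ord0 i) = t ord0 i + c * ((a ord0 i - c^-1) * t ord0 i))%R.
    by field; rewrite gt_eqF.
  rewrite lerD2l; apply: le_trans (ler_norm _) _.
  rewrite !normrM mulrA ler_wpM2r // (gtr0_norm c0) distrC mulrC -ler_pdivlMr //.
  exact: ltW (ha i).
rewrite negb_exists => /forallP tneg; right.
apply: sumr_le0 => k _; apply: mulr_ge0_le0; last by rewrite ltW // ltNge.
have := ha k; rewrite ltr_norml => /andP[_ h].
have : (d / c <= c^-1)%R by rewrite ler_pdivrMr // mulVf // gt_eqF.
lra.
Qed.

Lemma sup_ratio_ge0 : 0 <= sup_ratio u.
Proof.
have st0 : (0 < \sum_(k < n) (const_mx 1%R : 'rV[R]_n) ord0 k)%R.
  under eq_bigr do rewrite mxE.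
  by rewrite sumr_const card_ord ltr0n.
have [e r0] := eratio_psi _ st0.
apply: (@le_trans _ _ (eratio (dotR (const_mx 1%R) (one_vec R n)) (psi u (const_mx 1%R)))).
  by rewrite e lee_fin divr_ge0 // ltW.
by apply: ereal_sup_ubound; exists (const_mx 1%R) => //=; rewrite /Hplus /= dotR_onel.
Qed.

End main_equivalences.

(** The set is squeezed between the open and the closed ray from [S], so the endpoint, where
    integrability and membership in [Gamma_inf] may differ, does not affect the infimum. *)
Lemma ereal_inf_ray {R : realType} (S : \bar R) (A : set R) : 0 <= S ->
  (forall c : R, (0 < c)%R -> S < c%:E -> A c) -> (forall c : R, A c -> S <= c%:E) ->
  ereal_inf [set c%:E | c in A] = S.
Proof.
move=> S0 hA AS; apply/eqP; rewrite eq_le; apply/andP; split; last first.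
  by apply: le_ereal_inf_tmp => _ [c Ac <-]; exact: AS.
case: S S0 hA {AS} => [s| |//] S0 hA; last by rewrite leey.
apply/lee_addgt0Pr => e e0; rewrite lee_fin in S0.
apply: ereal_inf_lbound; exists (s + e)%R => //; apply: hA; first lra.
by rewrite lte_fin ltrDl.
Qed.

Theorem theorem7p2 (R : realType) (n : nat) (u : Cn R n -> \bar R) (K : set (Cn R n)) :
  (0 < n)%N -> LPSHstar u -> toric u -> compact K -> @unit_polydisk R n `<=` K ->
  (forall c : R, (0 < c)%R ->
     (int_outside K (fun z => expeR (- (2 * c)%:E * u z)) < +oo <-> sup_ratio u < c%:E)
  /\ (int_outside K (fun z => expeR (- (2 * c)%:E * u z)) < +oo <->
        interior (Gamma_inf u) (c^-1 *: one_vec R n)))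
  /\ c_inf u = c_inf (Psi u)
  /\ c_inf (Psi u) = sup_ratio u
  /\ sup_ratio u =
       ereal_inf [set c%:E | c in [set c : R | (0 < c)%R /\ Gamma_inf u (c^-1 *: one_vec R n)]].
Proof.
move=> n0 su tu cK DK.
have int_iff c : (0 < c)%R -> int_outside K (fun z => expeR (- (2 * c)%:E * u z)) < +oo <->
    dominates (log_profile u) c.
  move=> c0; split; first by apply: int_lty_dominates => //; left.
  by move=> dom; case: (dominates_int_lty u n0 su tu K c c0 DK dom).
have cinf v : v = u \/ v = Psi u -> c_inf v = sup_ratio u.
  move=> vE; apply: ereal_inf_ray; first exact: sup_ratio_ge0.
  - move=> c c0 /(sup_ratio_lt u n0 su tu c c0) dom; split=> //; exists K; split=> //.
    have [h1 h2] := dominates_int_lty u n0 su tu K c c0 DK dom.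
    by case: vE => ->; [move: h1|move: h2]; congr (_ < _); congr (int_outside _ _);
      apply/funext => z; rewrite abse_expeR_sqr.
  (* Divergence holds outside every compact set, so the [K'] given by [L2inf] need not contain the
     polydisk. *)
  - move=> c [c0 [K' [cK' fin]]]; apply/ltW/(sup_ratio_lt u n0 su tu c c0).
    apply: (int_lty_dominates u n0 su tu K' v c c0 cK' vE).
    move: fin; congr (_ < _); congr (int_outside _ _).
    by apply/funext => z; rewrite abse_expeR_sqr.
split; last first.
  split; first by rewrite !cinf; [|right|left].
  split; first by rewrite cinf; [|right].
  apply/esym/ereal_inf_ray; first exact: sup_ratio_ge0.
  - move=> c c0 /ltW Sc; split=> //; exact/(Gamma_sup_ratio u n0 su tu c c0).
  - by move=> c [c0 /(Gamma_sup_ratio u n0 su tu c c0)].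
move=> c c0; split; first by rewrite int_iff // sup_ratio_lt.
by rewrite int_iff // interior_Gamma_dominates.
Qed.
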